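(* Let $P(\theta)$ be a (data-independent) prior distribution over the parameters $\theta$ of the score function. Let $D_N$ be a set of $N$ i.i.d. samples from $\mathcal{D}$, and let $\delta\in(0,1)$. Choose the empirical coverage parameter $\hat\alpha\in(0,1)$ such that $N>1/\hat\alpha-1$. Then, with probability greater than $1-\delta$ over the sampling of $D_N$, the following holds simultaneously for all distributions $Q(\theta)$: $$\mathrm{kl}\left(\frac{\lfloor (N+1)\hat\alpha\rfloor-1}{N-1}\,\Big\Vert\,\mathcal{L}_{\mathrm{cov}}(Q)\right)\le\frac{\mathrm{KL}(Q\Vert P)+\log\left(\frac{B(N)}{\delta}\right)}{N-1},$$ where $\mathrm{kl}(p\Vert q)$ is the KL divergence between Bernoulli distributions with success probabilities $p$ and $q$ respectively, and $$B(N):=\mathrm{Beta}\left(\tfrac{k-1}{N-1};\,k,\,N+1-k\right)=O\left(\sqrt{N/(\hat\alpha(1-\hat\alpha))}\right),\qquad k=\lfloor (N+1)\hat\alpha\rfloor.$$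
   Context: Setting: $\mathcal{X}$ is an input space, $\mathcal{Y}$ a label space, $\mathcal{D}$ the joint probability distribution over inputs and labels $(x,y)\in\mathcal{X}\times\mathcal{Y}$, and $s(x,y;\theta)\in\mathbb{R}$ a score (nonconformity) function depending on parameters $\theta\in\mathbb{R}^d$. Prediction set: for a threshold $\tau\in\mathbb{R}$, $C(x;\tau,\theta)=\{y\in\mathcal{Y}: s(x,y;\theta)\le\tau\}$. Calibrated threshold: for a data set $D_N=\{(x_i,y_i)\}_{i=1}^N$, $\tau^*(D_N,\hat\alpha;\theta)$ is the $\lceil (N+1)(1-\hat\alpha)\rceil/N$ quantile of the set of scores $\{s(x_i,y_i;\theta)\}_{i=1}^N$. Randomized miscoverage rate: for a distribution $Q$ over $\theta$ (which may depend on $D_N$), $$\mathcal{L}_{\mathrm{cov}}(Q)=\mathbb{E}_{\theta\sim Q}\Big[\mathbb{P}_{(x,y)\sim\mathcal{D}}\big(y\notin C(x;\tau^*(D_N,\hat\alpha;\theta),\theta)\big)\Big],$$ the probability of miscoverage on a new test point, marginalized over the sampling of $\theta$, with the calibration set $D_N$ fixed. Divergences: $\mathrm{KL}(Q\Vert P)$ is the Kullback–Leibler divergence, and $\mathrm{kl}(p\Vert q)=p\log\frac{p}{q}+(1-p)\log\frac{1-p}{1-q}$. Beta density: $\mathrm{Beta}(a;\,k,\,N+1-k)=\frac{N!}{(k-1)!\,(N-k)!}a^{k-1}(1-a)^{N-k}$ is the density at $a$ of the Beta distribution with parameters $k$ and $N+1-k$.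
   Formalization: Adds that for P-almost every θ the score s(x,y;θ) under D has no atoms (no ties), since a constant score makes L_cov(Q)=0 and the left side infinite when k≥2; also takes N>1, since the formula divides by N−1. *)

(* Defs.v *)
From HB Require Import structures.
From mathcomp Require Import all_boot all_order all_algebra.
From mathcomp Require Import all_classical all_reals all_analysis.

Set Implicit Arguments.
Unset Strict Implicit.
Unset Printing Implicit Defensive.

Import Order.TTheory GRing.Theory Num.Theory.
Import numFieldNormedType.Exports.

Local Open Scope classical_set_scope.
Local Open Scope charge_scope.
Local Open Scope ring_scope.

(* Mutual independence: the product rule for every finite subfamily [J]. *)
Definition mutually_independent (R : realType) (dO dT : measure_display)
    (Omega : measurableType dO) (T : measurableType dT)
    (Pr : probability Omega R) (I : finType) (Z : I -> {RV Pr >-> T}) : Prop :=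
  forall (J : {set I}) (A : I -> set T), (forall i, measurable (A i)) ->
    Pr (\bigcap_(i in [set` J]) (Z i @^-1` A i)) =
    (\prod_(i in J) Pr (Z i @^-1` A i))%E.

Definition iid (R : realType) (dO dT : measure_display)
    (Omega : measurableType dO) (T : measurableType dT)
    (Pr : probability Omega R) (D : probability T R) (I : finType)
    (Z : I -> {RV Pr >-> T}) : Prop :=
  mutually_independent Z /\
  forall i A, measurable A -> distribution Pr (Z i) A = D A.

(* KL(Q || P) is +oo when Q is not absolutely continuous with respect to P. *)
Definition KL (R : realType) (dT : measure_display) (T : measurableType dT)
    (Q P : probability T R) : \bar R :=
  if `[< Q `<< P >]
  then (\int[Q]_t lne (('d (charge_of_finite_measure Q) '/d P) t))%E
  else +oo%E.

(* For p, q in [0, 1]. The arithmetic of \bar R (0^-1 = +oo, 0 * -oo = 0,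
   lne 0 = -oo, lne +oo = +oo) gives the usual conventions
   0 log (0 / q) = 0 and p log (p / 0) = +oo for p > 0. *)
Definition kl (R : realType) (p q : \bar R) : \bar R :=
  (p * lne (p / q) + (1 - p) * lne ((1 - p) / (1 - q)))%E.

Lemma klE (R : realType) (p q : R) : 0 < p < 1 -> 0 < q < 1 ->
  kl p%:E q%:E = (p * ln (p / q) + (1 - p) * ln ((1 - p) / (1 - q)))%:E.
Proof.
move=> /andP[p0 p1] /andP[q0 q1].
have p1' : 0 < 1 - p by rewrite subr_gt0.
have q1' : 0 < 1 - q by rewrite subr_gt0.
rewrite /kl -!EFinB !inver (gt_eqF q0) (gt_eqF q1') -!EFinM.
by rewrite !lne_EFin ?divr_gt0.
Qed.

Lemma kl0e (R : realType) (q : R) : 0 <= q < 1 ->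
  kl 0%E q%:E = (- ln (1 - q))%:E.
Proof.
move=> /andP[q0 q1]; have h : 0 < 1 - q by rewrite subr_gt0.
rewrite /kl mul0e add0e sube0 mul1e -EFinB inver (gt_eqF h) mul1e.
by rewrite lne_EFin ?invr_gt0// lnV// posrE.
Qed.

Lemma kle0 (R : realType) (p : R) : 0 < p <= 1 -> kl p%:E 0%E = +oo%E.
Proof.
move=> /andP[p0 p1]; rewrite /kl inve0 gt0_muley ?lte_fin//= gt0_muley ?lte_fin//.
rewrite addye// sube0 inve1 mule1 -EFinB.
have [->|h] := eqVneq p 1; first by rewrite subrr mul0e.
by rewrite lne_EFin// subr_gt0 lt_neqAle h.
Qed.

(* The q-quantile of the empirical distribution of s_1, ..., s_N: the least t
   such that at least a fraction q of the scores are at most t. *)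
Definition emp_quantile (R : realType) (N : nat) (s : 'I_N -> R) (q : R) : R :=
  inf [set t : R | q <= #|[set i | s i <= t]%SET|%:R / N%:R].

Section conformal.
Context (R : realType) (dX dY dT : measure_display) (X : measurableType dX)
  (Y : measurableType dY) (Theta : measurableType dT).
Variables (D : probability (X * Y)%type R) (s : X -> Y -> Theta -> R).

Definition prediction_set (x : X) (tau : R) (theta : Theta) : set Y :=
  [set y | s x y theta <= tau].

Definition calibrated_threshold (N : nat) (DN : 'I_N -> X * Y) (alpha : R)
    (theta : Theta) : R :=
  emp_quantile (fun i => s (DN i).1 (DN i).2 theta)
    ((Num.ceil (N.+1%:R * (1 - alpha)))%:~R / N%:R).

Definition Lcov (N : nat) (DN : 'I_N -> X * Y) (alpha : R)
    (Q : probability Theta R) : \bar R :=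
  (\int[Q]_theta D [set z : X * Y |
     ~ prediction_set z.1 (calibrated_threshold DN alpha theta) theta z.2])%E.

End conformal.

(* [Num.truncn] is the floor, as a natural number, of a nonnegative real. *)
Definition kfloor (R : realType) (alpha : R) (N : nat) : nat :=
  Num.truncn (N.+1%:R * alpha).

Definition Bconst (R : realType) (alpha : R) (N : nat) : R :=
  let k := kfloor alpha N in
  beta_pdf k (N.+1 - k) ((k%:R - 1) / (N%:R - 1)).

Lemma beta_pdf_factE (R : realType) (N k : nat) (a : R) :
  (0 < k <= N)%N -> 0 <= a <= 1 ->
  beta_pdf k (N.+1 - k) a =
  N`!%:R / ((k.-1)`!%:R * (N - k)`!%:R) * a ^+ k.-1 * (1 - a) ^+ (N - k).
Proof.
case: k => // k /andP[_ kN] a01.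
rewrite /beta_pdf patchE ifT; last by rewrite inE/= in_itv.
have -> : (N.+1 - k.+1 = (N - k.+1).+1)%N by rewrite -subSn.
rewrite beta_fun_fact -addSn subnKC// /XMonemX /= natrM.
by rewrite invf_div mulrC !mulrA.
Qed.

(* Main.v *)
Require Import Defs.
From HB Require Import structures.
From mathcomp Require Import all_boot all_order all_algebra.
From mathcomp Require Import all_classical all_reals all_analysis.
From mathcomp Require Import measurable_realfun.
From mathcomp Require Import ring lra zify.

Set Implicit Arguments.
Unset Strict Implicit.
Unset Printing Implicit Defensive.

Import Order.TTheory GRing.Theory Num.Theory.
Import numFieldNormedType.Exports.

Local Open Scope classical_set_scope.
Local Open Scope ring_scope.

(** With k = floor((N+1) alpha), the calibrated threshold is the (N+1-k)-th
    smallest score. Write L for the miscoverage probability of a fixed theta and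
    p = (k-1)/(N-1). Since exp((N-1) kl(p || x)) is
    p^(k-1) (1-p)^(N-k) / (x^(k-1) (1-x)^(N-k)), its expectation at x = L is at
      most
    B(N): almost surely the threshold is the score of some point i, and
      exactly k-1
    of the other points, forming a set J, have a larger score; conditionally on
    point i this has probability L^(k-1) (1-L)^(N-k), which cancels the
      denominator,
    and there are N C(N-1, k-1) pairs (i, J). Averaging over the prior
      (Tonelli) and
    Markov's inequality give the event. On it, the Donsker-Varadhan inequality is
    applied to affine minorants of (N-1) kl(p || L), whose supremum at the
    Q-mean of L is kl(p || Lcov(Q)); no Jensen inequality is needed. The bound on
    B(N) follows from Stirling-type bounds on n! e^n / n^n. *)

(** * Integrals of functions of independent variables over an event *)

Lemma ge0_integral_mrestr d (T : measurableType d) (R : realType)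
    (mu : {measure set T -> \bar R}) (E : set T) (mE : measurable E)
    (f : T -> \bar R) :
  measurable_fun [set: T] f -> (forall x, 0 <= f x)%E ->
  (\int[mrestr mu mE]_x f x = \int[mu]_(x in E) f x)%E.
Proof.
move=> mf f0; rewrite [LHS](@ge0_negligible_integral _ _ _ _ _ (~` E)) //.
- rewrite setTD setCK; apply: eq_measure_integral => A mA AE.
  by rewrite /= /mrestr setIidl.
- exact: measurableC.
- by rewrite /= /mrestr setICl.
Qed.

(** Under [Pr] restricted to [E], the joint law of [(U, V)] agrees on rectangles with the product of
    the law of [U], a finite measure of mass [Pr E], and [D]. Uniqueness of product measures
    identifies the two, and Tonelli integrates [V] out. *)
Lemma indep_restrict_integral d d1 d2 (W : measurableType d)
    (T1 : measurableType d1) (T2 : measurableType d2) (R : realType)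
    (Pr : probability W R) (D : probability T2 R) (E : set W)
    (U : W -> T1) (V : W -> T2) (h : T1 * T2 -> \bar R) :
  measurable E -> measurable_fun [set: W] U -> measurable_fun [set: W] V ->
  (forall A B, measurable A -> measurable B ->
     Pr (U @^-1` A `&` V @^-1` B `&` E) = (Pr (U @^-1` A `&` E) * D B)%E) ->
  measurable_fun [set: T1 * T2] h -> (forall x, 0 <= h x)%E ->
  (\int[Pr]_(w in E) h (U w, V w) = \int[Pr]_(w in E) \int[D]_y h (U w, y))%E.
Proof.
move=> mE mU mV indep mh h0.
have mUV : measurable_fun [set: W] (fun w => (U w, V w)).
  exact: measurable_fun_pair.
have Eoo : (Pr E < +oo)%E by rewrite ltey_eq fin_num_measure.
pose PrE := mfrestr mE Eoo.
have fin1 : fin_num_fun (pushforward PrE U).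
  by move=> A mA; apply: fin_num_measure; rewrite -[X in measurable X]setTI;
    exact: mU.
(* The measure instance of [pushforward] is a function of the measurability
   proof, hence the detour through [m1_] (and [m2_] below). *)
pose m1_ : {measure set T1 -> \bar R} := pushforward PrE U.
pose m1' := m1_ mU.
pose m1f := Measure_isFinite.Build _ _ _ m1' fin1.
pose m1 : {finite_measure set T1 -> \bar R} := HB.pack (Measure.sort m1') m1f.
have mhD : measurable_fun [set: T1] (fun x => \int[D]_y h (x, y))%E.
  exact: (@measurable_fun_fubini_tonelli_F _ _ _ _ _ D h).
transitivity (\int[PrE]_w h (U w, V w))%E.
  by rewrite ge0_integral_mrestr//; exact: measurableT_comp mh mUV.
pose m2_ : {measure set (T1 * T2) -> \bar R} :=
  pushforward PrE (fun w => (U w, V w)).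
pose m2 := m2_ mUV.
transitivity (\int[m2]_z h z)%E.
  by rewrite ge0_integral_pushforward.
transitivity (\int[(m1 \x D)%E]_z h z)%E.
  by apply: eq_measure_integral => A mA _; apply/esym/product_measure_unique.
rewrite fubini_tonelli1//.
transitivity (\int[PrE]_w \int[D]_y h (U w, y))%E; last first.
  rewrite ge0_integral_mrestr//; first exact: (measurableT_comp mhD mU).
  by move=> w; exact: integral_ge0.
rewrite /fubini_F /= ge0_integral_pushforward// => x _.
exact: integral_ge0.
Qed.

Lemma measurable_fin_forall d (T : measurableType d) (I : finType)
    (P : I -> set T) :
  (forall i, measurable (P i)) -> measurable [set x | forall i, P i x].
Proof.
move=> mP; rewrite (_ : [set _ | _] = \bigcap_(i in [set: I]) P i).
  by apply: fin_bigcap_measurable => // i _; exact: mP.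
by apply/seteqP; split => x /= Px i; [move=> _|]; exact: Px.
Qed.

Section iid_integral.
Context (R : realType) (dO dT : measure_display) (Omega : measurableType dO)
  (T : measurableType dT) (Pr : probability Omega R) (D : probability T R)
  (I : finType) (Z : I -> {RV Pr >-> T}) (i0 : I).
Hypothesis Z_iid : iid D Z.
Variables (Q : I -> set (T * T)).
Hypothesis mQ : forall j, measurable (Q j).

(* [Z i0] is the pivot: for [j] in [K] the pair [(Z i0, Z j)] is constrained to
   [Q j], for the other [j] only [Z j] is constrained, so that an induction on [K]
   can trade a relation to the pivot for a rectangle. *)
Definition cross_event (K : {set I}) (B : I -> set T) : set Omega :=
  [set w | forall j, j != i0 ->
     if j \in K then Q j (Z i0 w, Z j w) else B j (Z j w)].

Lemma measurable_cross_event K B :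
  (forall j, measurable (B j)) -> measurable (cross_event K B).
Proof.
move=> mB; apply: measurable_fin_forall => j.
have [->|ji0] := eqVneq j i0; first by rewrite [X in measurable X](_ : _ =
  setT)//; apply/seteqP; split.
rewrite [X in measurable X](_ : _ = if j \in K then (fun w =>
  (Z i0 w, Z j w)) @^-1` Q j
   else Z j @^-1` B j); last first.
  apply/seteqP; split => w /=; case: ifP => jK //=; exact.
case: ifP => _; rewrite -[X in measurable X]setTI.
  by apply: measurable_fun_pair => //; exact: mQ.
by apply: measurable_funPT => //; exact: mB.
Qed.

Lemma cross_event0_prob (A : set T) (B : I -> set T) :
  measurable A -> (forall j, measurable (B j)) ->
  Pr (Z i0 @^-1` A `&` cross_event finset.set0 B) =
  (D A * \prod_(j in [set~ i0]%SET) D (B j))%E.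
Proof.
move=> mA mB; have [indep idd] := Z_iid.
pose C j := if j == i0 then A else B j.
have mC j : measurable (C j) by rewrite /C; case: ifP.
rewrite (_ : _ `&` _ = \bigcap_(i in [set` [set: I]%SET]) (Z i @^-1` C i)).
  rewrite indep// (bigD1 i0)//= {1}/C eqxx; congr (_ * _)%E.
    by rewrite -(idd i0).
  apply: eq_big => [j|j]; first by rewrite !inE.
  by rewrite !inE /= => /negbTE ji; rewrite /C ji -(idd j).
apply/seteqP; split => w /=.
  by move=> [Aw Bw] j _; rewrite /C; case: eqVneq => [->//|/Bw]; rewrite inE.
move=> h; split; first by have := h i0; rewrite /= inE /C eqxx; exact.
by move=> j ji; rewrite inE; have := h j; rewrite /= inE /C (negbTE ji); exact.
Qed.

(** Conditionally on the pivot being at [z], the constraints indexed by [K] are independent, each of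
    probability [D (xsection (Q j) z)]. The induction integrates one variable [Z j0] out at a time
    and absorbs its factor into [f]. *)
Lemma ge0_iid_integral (K : {set I}) (B : I -> set T) (f : T -> \bar R) :
  i0 \notin K -> (forall j, measurable (B j)) ->
  measurable_fun [set: T] f -> (forall x, 0 <= f x)%E ->
  (\int[Pr]_(w in cross_event K B) f (Z i0 w) =
   (\int[D]_z (f z * \prod_(j in K) D (xsection (Q j) z))) *
   \prod_(j in [set~ i0] :\: K) D (B j))%E.
Proof.
have [n] := ubnP #|K|; elim: n K B f => // n IH K B f;
  rewrite ltnS => Kn i0K mB mf f0.
have [->|[j0 j0K]] := set_0Vmem K.
  transitivity (\int[Pr]_(w in cross_event finset.set0 B) cst
    (\int[D]_y f y) w)%E.
    (* For empty [K] the event does not involve the pivot, so the pivot itself is the variable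
       integrated out, paired with a constant. *)
    pose h (x : T * T) := f x.2.
    apply: (@indep_restrict_integral _ _ _ _ _ _ _ Pr D _ (cst point)
      (Z i0) h) => //.
    - exact: measurable_cross_event.
    - move=> A C mA mC; rewrite preimage_cst; case: ifPn => _; last first.
        by rewrite !set0I measure0 mul0e.
      rewrite !setTI cross_event0_prob//.
      rewrite -[X in (_ = Pr X * _)%E]setTI -(preimage_setT (Z i0)).
      by rewrite cross_event0_prob// probability_setT mul1e muleC.
    - exact: measurableT_comp.
    by move=> x; exact: f0.
  transitivity ((\int[D]_y f y) * Pr (cross_event finset.set0 B))%E.
    exact: integral_cst (measurable_cross_event finset.set0 mB) _.
  rewrite -[X in Pr X]setTI -(preimage_setT (Z i0)) cross_event0_prob//.
  rewrite probability_setT mul1e finset.setD0; congr (_ * _)%E.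
  by apply: eq_integral => z _; rewrite big_set0 mule1.
have mE := measurable_cross_event.
pose K' := (K :\ j0)%SET.
have K'n : (#|K'| < n)%N by rewrite (leq_trans _ Kn)// [X in
  (_ < X)%N](cardsD1 j0) j0K.
have i0K' : i0 \notin K' by rewrite !inE (negbTE i0K) andbF.
have j0i0 : j0 != i0 by apply: contraNneq i0K => <-.
(* With [j0] removed from [K], the constraint on [Z j0] is the rectangle side [C], which is free to
   vary. *)
pose B_ C j := if j == j0 then C else B j.
have mB_ C : measurable C -> forall j, measurable (B_ C j).
  by move=> mC j; rewrite /B_; case: ifP.
have EB_ C : cross_event K' (B_ C) = Z j0 @^-1` C `&` cross_event K' (B_ setT).
  apply/seteqP; split => w /=.
    move=> h; split; first by have := h _ j0i0; rewrite !inE eqxx /= /B_ eqxx.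
    by move=> j /h; case: ifP => // _; rewrite /B_; case: ifP.
  move=> [Cw h] j /h; case: ifP => // _; rewrite /B_; case: eqVneq => // ->.
  exact.
have prodB_ C : (\prod_(j in [set~ i0] :\: K') D (B_ C j) =
    D C * \prod_(j in [set~ i0] :\: K) D (B j))%E.
  rewrite (bigD1 j0) /=; last by rewrite !inE eqxx j0i0.
  congr (_ * _)%E; first by rewrite /B_ eqxx.
  apply: eq_big => j; first by rewrite !inE; case: eqVneq => [->|];
    rewrite ?j0K ?andbF ?andbT.
  by move=> /andP[_ /negbTE jj0]; rewrite /B_ jj0.
have EK : cross_event K B = cross_event K' (B_ setT) `&`
    (fun w => (Z i0 w, Z j0 w)) @^-1` Q j0.
  apply/seteqP; split => w /=.
    move=> h; split; last by have := h _ j0i0; rewrite j0K.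
    by move=> j /h; rewrite !inE /B_; case: eqVneq.
  move=> [h Qw] j /h; rewrite !inE /B_; case: eqVneq => [->|//]; by rewrite j0K.
pose h (x : T * T) := (f x.1 * (\1_(Q j0) x)%:E)%E.
have mh : measurable_fun [set: T * T] h.
  apply: emeasurable_funM; first exact: measurableT_comp mf _.
  by apply/measurable_EFinP; exact: measurable_indic.
have h0 x : (0 <= h x)%E by rewrite mule_ge0// lee_fin.
have hint x : (\int[D]_y h (x, y) = f x * D (xsection (Q j0) x))%E.
  rewrite /h /= ge0_integralZl//; last first.
    by apply/measurable_EFinP; apply: measurableT_comp => //;
      exact: measurable_indic.
  congr (_ * _)%E; rewrite -[xsection _ _]setIT -integral_indic//;
    last exact: measurable_xsection.
  apply: eq_integral => y _; by rewrite !indicE mem_xsection.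
transitivity (\int[Pr]_(w in cross_event K' (B_ setT)) h (Z i0 w, Z j0 w))%E.
  rewrite EK integral_mkcondr; apply: eq_integral => w _.
  by rewrite epatch_indic /h.
rewrite (@indep_restrict_integral _ _ _ _ _ _ _ Pr D _ (Z i0) (Z j0) h)//.
- under eq_integral do rewrite hint.
  pose f' x := (f x * D (xsection (Q j0) x))%E.
  rewrite (IH K' _ f')//.
  + rewrite prodB_ probability_setT mul1e; congr (_ * _)%E.
    apply: eq_integral => z _; rewrite /f' -muleA; congr (_ * _)%E.
    by rewrite [RHS](bigD1 j0)//=; congr (_ * _)%E; apply: eq_bigl => j;
      rewrite !inE andbC.
  + exact: mB_.
  + by apply: emeasurable_funM => //; exact: measurable_fun_xsection.
  + by move=> x; rewrite mule_ge0.
- exact/mE/mB_.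
- move=> A C mA mC.
  (* The independence of [Z j0] from the pivot and the smaller event is again the induction
     hypothesis, with the indicator of [A] for [f] and [C'] as the side at [j0]. *)
  have key C' : measurable C' -> Pr (Z i0 @^-1` A `&` cross_event K' (B_ C')) =
     ((\int[D]_z ((\1_A z)%:E * \prod_(j in K') D (xsection (Q j) z))) *
      (D C' * \prod_(j in [set~ i0] :\: K) D (B j)))%E.
    move=> mC'; rewrite -prodB_ -(IH K' (B_ C') (fun z => (\1_A z)%:E))//.
    - rewrite (_ : (fun w => _) = fun w => (\1_(Z i0 @^-1` A) w)%:E)//
      integral_indic//.
      exact/mE/mB_.
    - by rewrite -[X in measurable X]setTI; exact: measurable_funPT.
    - exact: mB_.
    - exact/measurable_EFinP.
  rewrite -setIA -EB_ !key// probability_setT mul1e.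
  by rewrite -muleA; congr (_ * _)%E; rewrite muleC.
Qed.
End iid_integral.

(** * Empirical quantiles as order statistics *)

Section quantile.
Context (R : realType) (N : nat) (s : 'I_N -> R) (r : nat).
Hypothesis rN : (0 < r <= N)%N.

(** Take [i0] of least score among the points with at least [r] scores at or below their own. By
    [top], any [r] points contain such a point, namely their maximizer; this gives both the strict
    count and the minimality over all real [t]. *)
Lemma emp_quantile_witness : exists i0 : 'I_N,
  [/\ (r <= #|[set i | (s i <= s i0)%R]%SET|)%N,
      (#|[set i | (s i < s i0)%R]%SET| < r)%N &
      forall t, (r <= #|[set i | (s i <= t)%R]%SET|)%N -> s i0 <= t].
Proof.
have [r0 rleN] := andP rN.
have N0 : (0 < N)%N by exact: leq_trans rleN.
have top (A : {set 'I_N}) : (r <= #|A|)%N -> exists2 i, i \in A &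
    (r <= #|[set j | (s j <= s i)%R]%SET|)%N.
  move=> rA; have /card_gt0P[k kA] : (0 < #|A|)%N by exact: leq_trans rA.
  case: (@arg_maxP _ _ _ k (mem A) s kA) => i iA imax.
  exists i => //; apply: (leq_trans rA); apply: subset_leq_card.
  by apply/fintype.subsetP => j jA; rewrite inE; exact: imax.
have [im _ rim] : exists2 i, i \in [set: 'I_N]%SET &
    (r <= #|[set j | (s j <= s i)%R]%SET|)%N.
  by apply: top; rewrite cardsT card_ord.
case: (@arg_minP _ _ _ im (fun i => r <= #|[set j |
  (s j <= s i)%R]%SET|)%N s rim).
move=> i0 ri0 i0min; exists i0; split => //.
  rewrite ltnNge; apply/negP => /top[i]; rewrite inE => ii0 /i0min.
  by rewrite leNgt ii0.
by move=> t /top[i]; rewrite inE => it /i0min; move/le_trans; exact.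
Qed.

Lemma emp_quantile_set :
  [set t : R | (r%:R / N%:R : R) <= #|[set i | (s i <= t)%R]%SET|%:R / N%:R] =
  [set t | (r <= #|[set i | (s i <= t)%R]%SET|)%N].
Proof.
have [r0 rleN] := andP rN.
have N0 : 0 < N%:R :> R by rewrite ltr0n; exact: leq_trans rleN.
by apply/seteqP; split => t /=; rewrite ler_pM2r ?invr_gt0// ler_nat.
Qed.

Lemma emp_quantileE : exists i0 : 'I_N,
  [/\ emp_quantile s (r%:R / N%:R) = s i0,
     (r <= #|[set i | (s i <= s i0)%R]%SET|)%N,
     (#|[set i | (s i < s i0)%R]%SET| < r)%N &
     forall t, (r <= #|[set i | (s i <= t)%R]%SET|)%N -> s i0 <= t].
Proof.
have [i0 [h1 h2 h3]] := emp_quantile_witness.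
exists i0; split => //; rewrite /emp_quantile emp_quantile_set.
apply/eqP; rewrite eq_le; apply/andP; split.
  by apply: ge_inf => //; exists (s i0) => t /h3.
by apply: lb_le_inf; [exists (s i0)|move=> t /h3].
Qed.

Lemma emp_quantile_le t :
  (emp_quantile s (r%:R / N%:R) <= t) =
  (r <= #|[set i | (s i <= t)%R]%SET|)%N.
Proof.
have [i0 [-> h1 _ h3]] := emp_quantileE.
apply/idP/idP; last exact: h3.
move=> it; apply: (leq_trans h1); apply: subset_leq_card.
by apply/fintype.subsetP => j; rewrite !inE => /le_trans; apply.
Qed.

(** Without ties, only [i0] separates the scores at most [s i0] from those strictly below; the first
    count is at least [r] and the second less than [r], so the first is exactly [r]. *)
Lemma emp_quantile_inj : injective s ->
  exists i0 : 'I_N, emp_quantile s (r%:R / N%:R) = s i0 /\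
    #|[set i | (s i0 < s i)%R]%SET| = (N - r)%N.
Proof.
move=> s_inj; have [i0 [h1 h2 h3 _]] := emp_quantileE.
exists i0; split => //.
have E1 : [set i | (s i <= s i0)%R]%SET = (i0 |: [set i | (s i < s i0)%R])%SET.
  by apply/setP => i; rewrite !inE le_eqVlt (inj_eq s_inj).
have E2 : [set i | (s i0 < s i)%R]%SET = (~: [set i | (s i <= s i0)%R])%SET.
  by apply/setP => i; rewrite !inE -ltNge.
rewrite E2 cardsCs finset.setCK card_ord; congr (_ - _)%N; apply/eqP;
  rewrite eqn_leq h2 andbT.
by rewrite E1 cardsU1 inE ltxx.
Qed.
End quantile.

Lemma measurable_fin_exists d (T : measurableType d) (I : finType)
    (P : I -> set T) :
  (forall i, measurable (P i)) -> measurable [set x | exists i, P i x].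
Proof.
move=> mP; rewrite (_ : [set _ | _] = \bigcup_(i in [set: I]) P i).
  by apply: fin_bigcup_measurable => // i _; exact: mP.
by apply/seteqP; split => x /= [i]; [exists i|move=> _; exists i].
Qed.

(** The quantile is at most [t] iff all scores indexed by some [J] with at least [r] elements are at
    most [t]: a finite union of finite intersections. *)
Lemma measurable_emp_quantile d (W : measurableType d) (R : realType) (N r : nat)
    (f : 'I_N -> W -> R) :
  (0 < r <= N)%N -> (forall i, measurable_fun [set: W] (f i)) ->
  measurable_fun [set: W] (fun w => emp_quantile (f^~ w) (r%:R / N%:R)).
Proof.
move=> rN mf; apply: (measurability _ (RGenOInfty.measurableE R)).
move=> /= _ [_ [t ->] <-]; rewrite setTI.
rewrite [X in measurable X](_ : _ = ~` [set w | exists J : {set 'I_N},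
  (r <= #|J|)%N /\
    forall i, i \in J -> f i w <= t]); last first.
  apply/seteqP; split => w /=; rewrite in_itv /= andbT ltNge emp_quantile_le//.
    apply: contraNnot => -[J [rJ Jt]]; apply: (leq_trans rJ).
    by apply: subset_leq_card; apply/fintype.subsetP => i iJ; rewrite inE Jt.
  apply: contra_notN => h; exists [set i | (f i w <= t)%R]%SET; split => //.
  by move=> i; rewrite inE.
apply: measurableC; apply: measurable_fin_exists => J.
case: (boolP (r <= #|J|)%N) => rJ; last first.
  by rewrite [X in measurable X](_ : _ = set0)//; apply/seteqP; split => w //= [].
rewrite [X in measurable X](_ : _ =
    [set w | forall i, (if i \in J then [set w | f i w <= t] else setT) w]).
  apply: measurable_fin_forall => i; case: ifP => // _.
  rewrite -[X in measurable X]setTI (_ : [set w | _] = f i @^-1` `]-oo,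
    t]%classic).
    by apply: mf => //; exact: measurable_itv.
  by apply/seteqP; split => w /=; rewrite in_itv.
apply/seteqP; split => w /=.
  by move=> [_ h] i; case: ifP => // /h.
by move=> h; split => // i iJ; have := h i; rewrite iJ.
Qed.

Lemma measurable_ltr_set d (W : measurableType d) (R : realType) (f g : W -> R) :
  measurable_fun [set: W] f -> measurable_fun [set: W] g ->
  measurable [set w | f w < g w].
Proof.
move=> mf mg; have := @measurable_lte _ _ _ setT measurableT (EFin \o f)
  (EFin \o g).
rewrite setTI; apply; exact/measurable_EFinP.
Qed.

Lemma measurable_ler_set d (W : measurableType d) (R : realType) (f g : W -> R) :
  measurable_fun [set: W] f -> measurable_fun [set: W] g ->
  measurable [set w | f w <= g w].
Proof.
move=> mf mg; have := @measurable_lee _ _ _ setT measurableT (EFin \o f)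
  (EFin \o g).
rewrite setTI; apply; exact/measurable_EFinP.
Qed.

Lemma measurable_prob_gt d d' (W : measurableType d) (T : measurableType d')
    (R : realType) (D : probability T R) (a : W -> R) (f : W * T -> R) :
  measurable_fun [set: W] a -> measurable_fun [set: W * T] f ->
  measurable_fun [set: W] (fun w => D [set z | a w < f (w, z)]).
Proof.
move=> ma mf.
pose A := [set x : W * T | a x.1 < f x].
have mA : measurable A by apply: measurable_ltr_set => //;
  exact: measurableT_comp.
rewrite (_ : (fun w => _) = D \o xsection A);
  first exact: measurable_fun_xsection.
by apply/funext => w /=; congr (D _); apply/seteqP; split => z;
  rewrite /xsection /A /= inE.
Qed.

(** * The tail mass beyond an order statistic of i.i.d. scores *)

Section order_statistic.
Context (R : realType) (dO dT : measure_display) (Omega : measurableType dO)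
  (T : measurableType dT) (Pr : probability Omega R) (D : probability T R)
  (N : nat) (Z : 'I_N -> {RV Pr >-> T}) (S : T -> R).
Hypothesis Z_iid : iid D Z.
Hypothesis mS : measurable_fun [set: T] S.
Hypothesis no_ties : forall t, D [set z | S z = t] = 0%E.

(** A tie between [i] and [l] is a cross event with pivot [i] and its only real constraint at [l];
    given the pivot at [z] it has probability [D [set y | S y = S z]], which is zero. *)
Lemma ae_scores_injective :
  {ae Pr, forall w, injective (fun i => S (Z i w))}.
Proof.
suff h i l : i != l -> {ae Pr, forall w, S (Z i w) <> S (Z l w)}.
  have h' : {ae Pr, forall w, forall i l, i != l -> S (Z i w) <> S (Z l w)}.
    apply: filter_forall => i; apply: filter_forall => l.
    have [->|il] := eqVneq i l; first by apply: aeW.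
    by apply: filterS (h i l il) => w.
  apply: filterS h' => w hw i l Sil; apply/eqP/negPn/negP => il.
  exact: hw il Sil.
move=> il.
pose Q j : set (T * T) := if j == l then [set x | S x.1 = S x.2] else setT.
have mQl : measurable [set x : T * T | S x.1 = S x.2].
  rewrite [X in measurable X](_ : _ = [set x | S x.1 <= S x.2] `&` [set x | S x.2
    <= S x.1]).
    by apply: measurableI; apply: measurable_ler_set; exact: measurableT_comp.
  apply/seteqP; split => x /=; first by move=> ->.
  by move=> [h1 h2]; apply/eqP; rewrite eq_le h1.
have mQ j : measurable (Q j) by rewrite /Q; case: ifP.
exists (cross_event Z i Q [set~ i]%SET (fun=> setT)); split.
- exact: measurable_cross_event.
- rewrite -[LHS]mul1e -integral_cst; last exact: measurable_cross_event.
  rewrite (@ge0_iid_integral _ _ _ _ _ _ D _ Z i Z_iid Q mQ _ _ (cst 1%E))//.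
  + rewrite integral0_eq ?mul0e// => z _.
    rewrite (bigD1 l) /=; last by rewrite !inE eq_sym.
    rewrite (_ : D _ = 0%E) ?mul0e ?mule0// -[RHS](no_ties (S z)).
    congr (D _); apply/seteqP; split => y;
      by rewrite /xsection /= inE /Q eqxx.
  + by rewrite !inE eqxx.
- move=> w /= /contrapT Sil j ji; rewrite !inE ji /Q.
  by case: eqVneq => // ->.
Qed.

Local Open Scope ereal_scope.

Let G t := D [set z | (t < S z)%R].

(** Given point [i], with tail mass [x] beyond its score, the [j] points of [J] contribute [x ^+ j]
    and the [N - j.+1] remaining ones [(1 - x) ^+ (N - j.+1)]. The hypothesis on [phi] bounds the
    resulting integrand by [c] pointwise. *)
Lemma integral_score_rank (j : nat) (i : 'I_N) (J : {set 'I_N})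
    (phi : \bar R -> \bar R) (c : R) :
  measurable_fun [set: \bar R] phi -> (forall x, 0 <= phi x) ->
  (forall x : R, (0 <= x <= 1)%R ->
     phi x%:E * (x ^+ j * (1 - x) ^+ (N - j.+1))%:E <= c%:E) ->
  (J \subset [set~ i])%SET -> #|J| = j ->
  \int[Pr]_(w in [set w | forall l, l != i ->
      if l \in J then (S (Z i w) < S (Z l w))%R else (S (Z l w) <= S (Z i w))%R])
    phi (G (S (Z i w))) <= c%:E.
Proof.
move=> mphi phi0 phic Ji Jj.
pose Q l : set (T * T) := if l \in J then [set x | (S x.1 < S x.2)%R]
  else [set x | (S x.2 <= S x.1)%R].
have mQ l : measurable (Q l).
  rewrite /Q; case: ifP => _.
    by apply: measurable_ltr_set; exact: measurableT_comp.
  by apply: measurable_ler_set; exact: measurableT_comp.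
have mG : measurable_fun [set: R] G.
  by apply: (@measurable_prob_gt _ _ _ _ _ D id (fun x => S x.2)) => //;
    exact: measurableT_comp.
have mf : measurable_fun [set: T] (fun z => phi (G (S z))).
  by apply: measurableT_comp => //; exact: measurableT_comp.
rewrite [X in integral _ X](_ : _ = cross_event Z i Q [set~ i]%SET (fun=> setT));
  last first.
  by apply/seteqP; split => w /= h l li; have := h l li; rewrite !inE li /Q;
    case: ifP.
rewrite (@ge0_iid_integral _ _ _ _ _ _ D _ Z i Z_iid Q mQ _ _ (fun z => phi (G
  (S z))))//; last first.
  by rewrite !inE eqxx.
rewrite finset.setDv big_set0 mule1.
have <- : \int[D]_z (cst c%:E) z = c%:E.
  transitivity (c%:E * D setT); first exact: integral_cst.
  by rewrite probability_setT mule1.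
have QG z l : l \in [set~ i]%SET -> D (xsection (Q l) z) =
    if l \in J then G (S z) else 1 - G (S z).
  move=> _; rewrite /Q; case: ifP => _.
    by congr (D _); apply/seteqP; split => y; rewrite /xsection /= inE.
  rewrite /G -probability_setC; last first.
    by apply: measurable_ltr_set.
  congr (D _); apply/seteqP; split => y; rewrite /xsection /= inE /=.
    by rewrite leNgt => /negP.
  by move/negP; rewrite -leNgt.
pose g z := fine (G (S z)).
have gE z : G (S z) = (g z)%:E by rewrite /g fineK// fin_num_measure//;
  apply: measurable_ltr_set.
have g01 z : (0 <= g z <= 1)%R.
  by rewrite -!lee_fin -gE measure_ge0 probability_le1//;
    apply: measurable_ltr_set.
have mg : measurable_fun [set: T] g.
  apply: measurableT_comp => //; exact: measurableT_comp.
have prodE z : \prod_(l in [set~ i]%SET) D (xsection (Q l) z) =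
    (g z ^+ j * (1 - g z) ^+ (N - j.+1))%:E.
  rewrite (eq_bigr (fun l => (if l \in J then g z else 1 - g z)%:E)); last first.
    by move=> l li; rewrite QG// gE; case: ifP.
  rewrite prodEFin; congr EFin; rewrite (bigID (mem J)) /=; congr (_ * _)%R.
    rewrite (eq_bigr (fun=> g z)) => [|l /andP[_ ->]//].
    rewrite prodr_const -Jj; congr (_ ^+ _)%R; apply: eq_card => l.
    rewrite unfold_in /=; apply: andb_idl; exact: (fintype.subsetP Ji).
  rewrite (eq_bigr (fun=> 1 - g z)%R) => [|l /andP[_ /negbTE ->]//].
  rewrite prodr_const; congr (_ ^+ _)%R.
  rewrite (_ : #|_| = #|([set~ i] :\: J)%SET|); last first.
    by apply: eq_card => l; rewrite !inE unfold_in /= !inE andbC.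
  by rewrite cardsD cardsC1 card_ord (finset.setIidPr Ji) Jj -subn1 -subnDA.
under eq_integral do rewrite prodE.
apply: ge0_le_integral => //.
- move=> z _; rewrite mule_ge0// lee_fin; have /andP[g0 g1] := g01 z.
  by rewrite mulr_ge0// exprn_ge0// subr_ge0.
- apply: emeasurable_funM => //; apply/measurable_EFinP.
  by apply: measurable_funM; apply: measurable_funX => //; exact: measurable_funB.
by move=> z _; rewrite gE; exact: phic.
Qed.

Lemma card_pivot_choices (j : nat) :
  #|[set p : 'I_N * {set 'I_N} | (p.2 \subset [set~ p.1]) && (#|p.2| == j)]%SET| =
  (N * 'C(N.-1, j))%N.
Proof.
rewrite -sum1_card (eq_bigl (fun p : 'I_N * {set 'I_N} =>
  true && ((p.2 \subset [set~ p.1]) && (#|p.2| == j))))%SET; last first.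
  by move=> p; rewrite inE.
rewrite -(pair_big_dep xpredT (fun i (J : {set 'I_N}) =>
  ((J \subset [set~ i]) && (#|J| == j))%SET) (fun _ _ => 1%N)) /=.
rewrite (eq_bigr (fun=> 'C(N.-1, j))) => [|i _]; last first.
  rewrite sum1_card -[in RHS](card_ord N) -(cardsC1 i) -cards_draws.
  by apply: eq_card => J; rewrite !inE.
by rewrite sum_nat_const card_ord.
Qed.

(** The level [(N - j) / N] leaves exactly [j] scores above the threshold. The integrand is
    dominated by a sum over pairs of a pivot and a set of [j] larger scores, and each summand
    integrates to at most [c]. *)
Lemma integral_quantile_tail (j : nat) (phi : \bar R -> \bar R) (c : R) :
  (j < N)%N ->
  measurable_fun [set: \bar R] phi -> (forall x, 0 <= phi x) ->
  (forall x : R, (0 <= x <= 1)%R ->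
     phi x%:E * (x ^+ j * (1 - x) ^+ (N - j.+1))%:E <= c%:E) ->
  \int[Pr]_w phi (G (emp_quantile (fun i => S (Z i w)) ((N - j)%:R / N%:R)%R))
  <= ((N * 'C(N.-1, j))%:R * c)%:E.
Proof.
move=> jN mphi phi0 phic.
have rN : (0 < N - j <= N)%N by rewrite subn_gt0 jN leq_subr.
have mSZ i : measurable_fun [set: Omega] (fun w => S (Z i w)).
  exact: measurableT_comp.
have mG : measurable_fun [set: R] G.
  by apply: (@measurable_prob_gt _ _ _ _ _ D id (fun x => S x.2)) => //;
    exact: measurableT_comp.
have mtau := measurable_emp_quantile rN mSZ.
pose E (p : 'I_N * {set 'I_N}) := [set w | forall l, l != p.1 ->
  if l \in p.2 then (S (Z p.1 w) < S (Z l w))%R else (S (Z l w) <= S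
    (Z p.1 w))%R].
have mE p : measurable (E p).
  apply: measurable_fin_forall => l.
  have [->|lp] := eqVneq l p.1.
    by rewrite [X in measurable X](_ : _ = setT)//; apply/seteqP; split.
  case: (boolP (l \in p.2)) => lp2.
    rewrite [X in measurable X](_ : _ = [set w | (S (Z p.1 w) < S (Z l w))%R]).
      exact: measurable_ltr_set.
    by apply/seteqP; split => w //=; exact.
  rewrite [X in measurable X](_ : _ = [set w | (S (Z l w) <= S (Z p.1 w))%R]).
    exact: measurable_ler_set.
  by apply/seteqP; split => w //=; exact.
pose F (p : 'I_N * {set 'I_N}) w := phi (G (S (Z p.1 w))).
have F0 p w : 0 <= (F p \_ (E p)) w by rewrite patchE; case: ifP => // _;
  exact: phi0.
have mF p : measurable_fun [set: Omega] (F p \_ (E p)).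
  apply/(measurable_restrict _ (mE p)) => //; apply: measurable_funTS.
  by apply: measurableT_comp => //; exact: measurableT_comp.
pose A := [set p : 'I_N * {set 'I_N} | (p.2 \subset [set~ p.1]) &&
  (#|p.2| == j)]%SET.
apply: (@le_trans _ _ (\int[Pr]_w \sum_(p <- enum A) (F p \_ (E p)) w)).
  (* Without ties the threshold is the score of a unique pivot [i0], and the set of
     points with a larger score has exactly [j] elements: one summand suffices. *)
  apply: ae_ge0_le_integral => //.
  - by apply: measurableT_comp => //; exact: measurableT_comp.
  - by move=> w _; apply: sume_ge0.
  - exact: emeasurable_sum.
  apply: filterS ae_scores_injective => w w_inj _.
  have [i0 [-> J0]] := emp_quantile_inj rN w_inj.
  pose p0 := (i0, [set l | (S (Z i0 w) < S (Z l w))%R]%SET).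
  have p0A : p0 \in A.
    rewrite inE /= J0 subKn ?eqxx ?andbT//; last exact: ltnW.
    by apply/fintype.subsetP => l; rewrite !inE; apply: contraTneq => ->;
      rewrite ltxx.
  rewrite big_enum (bigD1 p0)//= -[leLHS]adde0; apply: leeD; last exact: sume_ge0.
  rewrite patchE mem_set// => l li; rewrite inE; case: ifPn => //.
  by rewrite -leNgt.
rewrite ge0_integral_sum//.
apply: (@le_trans _ _ (\sum_(p <- enum A) c%:E)).
  rewrite !big_enum; apply: lee_sum => -[i J];
    rewrite inE => /= /andP[Ji /eqP Jj].
  rewrite -integral_mkcond; exact: integral_score_rank phic Ji Jj.
by rewrite big_enum /= sumEFin lee_fin sumr_const card_pivot_choices mulr_natl.
Qed.
End order_statistic.

(** The usual Markov inequality only gives probability at least [1 - delta]; the strict bound comes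
    from excluding its equality case. *)
Lemma strict_markov d (W : measurableType d) (R : realType)
    (Pr : probability W R) (X : W -> \bar R) (b delta : R) :
  measurable_fun [set: W] X -> (forall w, 0 <= X w)%E ->
  (\int[Pr]_w X w <= b%:E)%E -> 0 < b -> 0 < delta ->
  ((1 - delta)%:E < Pr [set w | (X w <= (b / delta)%:E)%E])%E.
Proof.
move=> mX X0 Xb b0 delta0; set c := b / delta.
have c0 : 0 < c by rewrite divr_gt0.
pose F := [set w | (c%:E < X w)%E].
have mF : measurable F by rewrite -[F]setTI; exact: emeasurable_fun_o_infty.
rewrite (_ : [set w | _] = ~` F); last first.
  by apply/seteqP; split => w /=; rewrite leNgt => /negP.
rewrite probability_setC// ltNge; apply/negP => PrF.
(* If [Pr F >= delta], Markov's inequality is an equality, so that [X = c] almost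
   everywhere on [F = {X > c}], and [F] is negligible. *)
have {}PrF : (delta%:E <= Pr F)%E.
  move: PrF; rewrite -(@fineK _ (Pr F)) ?fin_num_measure// -EFinB !lee_fin; lra.
have mXc : measurable_fun F (fun w => X w - c%:E)%E.
  by apply/measurable_funTS/emeasurable_funB.
have Xc0 w : F w -> (0 <= X w - c%:E)%E.
  by move=> Fw; rewrite sube_ge0 ?orbT// ltW.
have intF : (\int[Pr]_(w in F) X w =
    \int[Pr]_(w in F) (X w - c%:E) + c%:E * Pr F)%E.
  rewrite -(integral_cst Pr mF) -ge0_integralD//.
    by apply: eq_integral => w _; rewrite subeK.
  by move=> w _; rewrite lee_fin ltW.
have intFb : (\int[Pr]_(w in F) X w <= b%:E)%E.
  by apply: le_trans Xb; exact: ge0_subset_integral.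
have cb : (b%:E <= c%:E * Pr F)%E.
  rewrite (_ : b = c * delta) ?EFinM; last by rewrite /c divfK// gt_eqF.
  by rewrite lee_pmul2l.
have int0 : (\int[Pr]_(w in F) (X w - c%:E) = 0)%E.
  apply/eqP; rewrite eq_le integral_ge0// andbT.
  rewrite -(@leeD2rE _ b%:E)// add0e; apply: le_trans intFb; rewrite intF.
  exact: leeD2l.
have /(ae_eq_integral_abs Pr mF mXc)[A [mA A0 FA]] :
    (\int[Pr]_(w in F) `|X w - c%:E| = 0)%E.
  by rewrite -int0; apply: eq_integral => w; rewrite inE => Fw;
    rewrite gee0_abs// Xc0.
have : (Pr F <= Pr A)%E.
  apply: le_measure; rewrite ?inE// => w Fw; apply: FA => h.
  have : (0 < X w - c%:E)%E by rewrite sube_gt0.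
  by rewrite (h Fw) ltxx.
by rewrite A0 => /(le_trans PrF); rewrite lee_fin leNgt delta0.
Qed.

(** * The Donsker-Varadhan inequality *)

Lemma ae_le_integral d (T : measurableType d) (R : realType)
    (mu : {measure set T -> \bar R}) (f g : T -> \bar R) :
  measurable_fun [set: T] f -> measurable_fun [set: T] g ->
  {ae mu, forall x, f x <= g x}%E -> (\int[mu]_x f x <= \int[mu]_x g x)%E.
Proof.
move=> mf mg fg; rewrite integralE [leRHS]integralE; apply: leeB.
  apply: ae_ge0_le_integral => //; try exact: measurable_funepos.
  by apply: filterS fg => x fgx _; rewrite !funeposE ge_max !le_max fgx lexx orbT.
apply: ae_ge0_le_integral => //; try exact: measurable_funeneg.
by apply: filterS fg => x fgx _; rewrite !funenegE ge_max !le_max leeN2 fgx lexx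
  orbT.
Qed.

Lemma measurable_lne (R : realType) : measurable_fun [set: \bar R] (@lne R).
Proof.
rewrite (_ : @lne R = fun x => if (x <= 0)%E then -oo%E
  else if x == +oo%E then +oo%E else (ln (fine x))%:E); last first.
  by apply/funext => -[r| |] /=; rewrite ?lee_fin ?leNye //; case: ifP.
apply: measurable_fun_ifT => //.
  apply: (measurable_fun_bool true); rewrite setTI.
  rewrite [X in measurable X](_ : _ = [set x | (x <= 0%:E)%E]).
    by rewrite -[X in measurable X]setTI; apply: emeasurable_fun_infty_c.
  by apply/seteqP; split.
apply: measurable_fun_ifT => //.
  apply: (measurable_fun_bool true); rewrite setTI.
  rewrite [X in measurable X](_ : _ = [set +oo%E]); first exact: emeasurable_set1.
  by apply/seteqP; split => x /= /eqP.
by apply/measurable_EFinP; apply: measurableT_comp.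
Qed.

Section donsker_varadhan.
Local Open Scope charge_scope.
Context d (T : measurableType d) (R : realType) (P Q : probability T R).
Variables (A : T -> R) (b M : R).
Hypothesis mA : measurable_fun [set: T] A.
Hypothesis A_bounded : forall x, `|A x| <= b.
Hypothesis M0 : 0 < M.
Hypothesis expA : (\int[P]_x (expR (A x))%:E <= M%:E)%E.

(** With [h] the density of [Q] and [g = expR A / h], the tangent bound for [ln] gives
    [A + 1 - ln M - g / M <= ln h] almost everywhere for [Q]. Changing measure, [g] has [Q]-integral
    at most that of [expR A] under [P], hence at most [M], so the terms [1] and [- g / M] have a
    nonnegative total. *)
Lemma donsker_varadhan : (\int[Q]_x (A x)%:E <= KL Q P + (ln M)%:E)%E.
Proof.
rewrite /KL; case: asboolP => QP; last by rewrite leey.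
pose h := Radon_Nikodym_SigmaFinite.f Q P.
have h0 x : (0 <= h x)%E by exact: Radon_Nikodym_SigmaFinite.f_ge0.
have hfin x : h x \is a fin_num by exact: Radon_Nikodym_SigmaFinite.f_fin_num.
have mh : measurable_fun [set: T] h.
  exact/measurable_int/Radon_Nikodym_SigmaFinite.f_integrable.
(* Replace the derivative by a version of the density that is finite and nonnegative everywhere. *)
have -> : (\int[Q]_t lne (('d (charge_of_finite_measure Q) '/d P) t) =
    \int[Q]_t lne (h t))%E.
  apply: ae_eq_integral => //.
  - by apply: measurableT_comp => //; exact: measurable_lne.
  - by apply: measurableT_comp => //; exact: measurable_lne.
  - have /(null_dominates_ae_eq measurableT QP) : ae_eq P setT h
      ('d (charge_of_finite_measure Q) '/d P).
      exact: ae_eq_Radon_Nikodym_SigmaFinite.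
    by apply: filterS => x /= hx _; rewrite hx.
pose g x := expR (A x) / fine (h x).
have g0 x : 0 <= g x by rewrite /g mulr_ge0 ?expR_ge0 ?invr_ge0 ?fine_ge0.
have mg : measurable_fun [set: T] g.
  apply: measurable_funM; first exact: measurableT_comp.
  rewrite (_ : (fun x => _) = fun x => fine (h x) `^ (- 1)); last first.
    by apply/funext => x; rewrite powR_inv1// fine_ge0.
  apply: (measurableT_comp (measurable_powR (-1))); exact: measurableT_comp.
have gM : (\int[Q]_x (g x)%:E <= M%:E)%E.
  rewrite -(@Radon_Nikodym_SigmaFinite.change_of_variables _ _ _ Q P QP
    (EFin \o g))//; last first.
    exact/measurable_EFinP.
  apply: le_trans expA; apply: ge0_le_integral => //.
  - by move=> x _; rewrite mule_ge0// lee_fin.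
  - by apply: emeasurable_funM => //; exact/measurable_EFinP.
  - by apply/measurable_EFinP; exact: measurableT_comp.
  move=> x _; rewrite -/h /= -(fineK (hfin x)) -EFinM lee_fin /g.
  (* Where the density vanishes, [g * h] is [0] rather than [expR A], hence an inequality and not an
     equality. *)
  have [->|hx] := eqVneq (fine (h x)) 0; first by rewrite mulr0 expR_ge0.
  by rewrite divfK.
(* The zero set of [h] has [Q]-measure equal to the integral of [h] over it. *)
have ae_h : {ae Q, forall x, 0 < h x}%E.
  have mN : measurable [set x | h x = 0%E].
    by rewrite -[X in measurable X]setTI; exact: (mh measurableT [set 0%E]).
  exists [set x | h x = 0%E]; split => //.
    by rewrite (Radon_Nikodym_SigmaFinite.f_integral QP)// integral0_eq.
  by move=> x /= /negP; rewrite -leNgt => hx; apply/eqP; rewrite eq_le hx h0.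
(* [ln u <= u - 1] at [u = expR (A x) / (M * h x)] *)
pose lo x := (A x + (1 - ln M)) - M^-1 * g x.
have lo_le : {ae Q, forall x, (lo x)%:E <= lne (h x)}%E.
  apply: filterS ae_h => x; rewrite -(fineK (hfin x)) lte_fin => hx.
  rewrite lne_EFin// lee_fin /lo /g; set y := fine (h x).
  have /le_ln1Dx : -1 < expR (A x) / (M * y) - 1.
    by rewrite -subr_gt0 opprK subrK divr_gt0 ?expR_gt0 ?mulr_gt0.
  rewrite addrC subrK ln_div ?posrE ?expR_gt0 ?mulr_gt0// expRK lnM ?posrE//.
  rewrite (_ : M^-1 * _ = expR (A x) / (M * y)); first by lra.
  by field; rewrite !gt_eqF.
have iA : Q.-integrable setT (EFin \o A).
  apply: measurable_bounded_integrable => //.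
    by rewrite -ge0_fin_numE// fin_num_measure.
  exists b; split; first exact: num_real.
  by move=> c bc x _ /=; exact: le_trans (A_bounded x) (ltW bc).
have ig : Q.-integrable setT (EFin \o g).
  apply/integrableP; split; first exact/measurable_EFinP.
  rewrite (eq_integral (fun x => (g x)%:E)).
    by apply: le_lt_trans gM _; rewrite ltry.
  by move=> x _ /=; rewrite ger0_norm.
have iA' : Q.-integrable setT (fun x => (A x + (1 - ln M))%:E).
  rewrite (_ : (fun x => _) = ((EFin \o A) \+ (EFin \o cst (1 - ln M)%R))%E)//.
  by apply: integrableD => //; exact: finite_measure_integrable_cst.
have igM : Q.-integrable setT (fun x => (M^-1 * g x)%:E).
  rewrite (_ : (fun x => _) = (fun x => M^-1%:E * (g x)%:E)%E)//.
  exact: integrableZl.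
have int_lo : (\int[Q]_x (lo x)%:E =
    (\int[Q]_x (A x)%:E + (1 - ln M)%:E) - M^-1%:E * \int[Q]_x (g x)%:E)%E.
  rewrite -integralZl// -[X in ((_ + X) - _)%E]mule1 -(probability_setT Q).
  have <- := integral_cst Q measurableT (1 - ln M)%:E.
  rewrite -integralD//; last exact: finite_measure_integrable_cst.
  by rewrite -integralB//.
have : (\int[Q]_x (lo x)%:E <= \int[Q]_t lne (h t))%E.
  apply: ae_le_integral => //.
    apply/measurable_EFinP; apply: measurable_funB; first exact: measurable_funD.
    exact: measurable_funM.
  by apply: measurableT_comp => //; exact: measurable_lne.
rewrite int_lo.
have Afin := integrable_fin_num measurableT iA.
have gfin := integrable_fin_num measurableT ig.
have g1 : M^-1 * fine (\int[Q]_x (EFin \o g) x) <= 1.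
  by rewrite ler_pdivrMl// mulr1 -lee_fin fineK.
rewrite -(fineK Afin) -(fineK gfin) -EFinM -EFinD => H.
by rewrite -leeBlDr// -EFinB; apply: le_trans H; rewrite lee_fin; lra.
Qed.
End donsker_varadhan.

(** * The Bernoulli divergence as a supremum of affine functions *)

Section affine_minorant.
Context (R : realType).
Implicit Types (p q u v x : R).

(* The affine minorant of [x |-> kl p x] obtained from the tangents of [ln] at [u]
   (for [x]) and at [v] (for [1 - x]); [u] and [v] are independent so that the
     values
   at [x = 0] and [x = 1] are suprema of minorants too. *)
Definition kl_affine p u v x : R :=
  p * ln p + (1 - p) * ln (1 - p) + p * (1 - ln u - x / u)
  + (1 - p) * (1 - ln v - (1 - x) / v).

Lemma kl_affineC p u v x : kl_affine p u v x = kl_affine (1 - p) v u (1 - x).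
Proof. by rewrite /kl_affine !subKr; lra. Qed.

Lemma klC p q : kl p%:E q%:E = kl (1 - p)%:E (1 - q)%:E.
Proof. by rewrite /kl -!EFinB !subKr addeC. Qed.

Lemma kl_affine_id p q : 0 < q < 1 -> kl_affine p q (1 - q) q =
  p * ln p + (1 - p) * ln (1 - p) - p * ln q - (1 - p) * ln (1 - q).
Proof.
move=> /andP[q0 q1]; rewrite /kl_affine !divff; first by lra.
  by rewrite gt_eqF// subr_gt0.
by rewrite gt_eqF.
Qed.

(** At [0] the first tangent term is [p * (1 - ln u)]. It vanishes for [p = 0], and for [p > 0] it
    is unbounded as [u] tends to [0], matching the infinite divergence. *)
Lemma kl_le_sup_affine0 p (C : \bar R) : 0 <= p <= 1 ->
  (forall u v, 0 < u -> 0 < v -> ((kl_affine p u v 0)%:E <= C)%E) ->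
  (kl p%:E 0%:E <= C)%E.
Proof.
move=> /andP[]; rewrite le_eqVlt => /predU1P[<- _|p0 p1] hC.
  rewrite kl0e ?lexx ?ltr01// subr0 ln1 oppr0.
  have := hC 1 1 ltr01 ltr01.
  by rewrite /kl_affine !subr0 ln1 !mul0r !mulr0 divr1 !add0r subr0 subrr mulr0.
rewrite (_ : C = +oo%E) ?leey//; apply: eq_infty => t.
pose y := t - (p * ln p + (1 - p) * ln (1 - p)).
(* This [u] makes the minorant at [0] equal to [t]; [v = 1] cancels the second tangent term. *)
have := hC (expR (1 - y / p)) 1 (expR_gt0 _) ltr01; apply: le_trans.
rewrite lee_fin /kl_affine expRK ln1 mul0r !subr0 divr1 subrr mulr0 addr0.
by rewrite subKr mulrCA divff ?gt_eqF// mulr1 /y; lra.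
Qed.

(** For [q] inside the unit interval the tangents at [q] and [1 - q] touch, so one minorant
    suffices. The endpoint [1] reduces to [0] by exchanging success and failure. *)
Lemma kl_le_sup_affine p q (C : \bar R) : 0 <= p <= 1 -> 0 <= q <= 1 ->
  (forall u v, 0 < u -> 0 < v -> ((kl_affine p u v q)%:E <= C)%E) ->
  (kl p%:E q%:E <= C)%E.
Proof.
move=> p01 /andP[]; rewrite le_eqVlt => /predU1P[<- _|q0];
  first exact: kl_le_sup_affine0.
have p01' : 0 <= 1 - p <= 1 by move: p01; lra.
rewrite le_eqVlt => /predU1P[->|q1] hC.
  rewrite klC subrr; apply: kl_le_sup_affine0 => // u v u0 v0.
  by have := hC v u v0 u0; rewrite kl_affineC subrr.
have q01 : 0 < q < 1 by rewrite q0.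
have q01' : 0 <= 1 - q < 1 by lra.
apply: le_trans (hC q (1 - q) _ _); rewrite ?subr_gt0// kl_affine_id//.
have [->|pN0] := eqVneq p 0.
  by rewrite kl0e ?(ltW q0)// subr0 ln1 lee_fin; lra.
have [->|pN1] := eqVneq p 1.
  by rewrite klC subrr kl0e// subKr ln1 lee_fin; lra.
have p01s : 0 < p < 1.
  by rewrite !lt_neqAle eq_sym pN0 pN1; move: p01 => /andP[-> ->].
rewrite klE// lee_fin !ln_div ?posrE ?subr_gt0//; [by lra|..];
  by case/andP: p01s.
Qed.

(** Exponential form of the tangent bound on [ln x], multiplied out so that it also covers
    [x = 0]. *)
Lemma expR_tangent_le1 u x : 0 < u -> 0 <= x ->
  expR (1 - ln u - x / u) * x <= 1.
Proof.
move=> u0; rewrite le_eqVlt => /predU1P[<-|x0]; first by rewrite mulr0 ler01.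
rewrite -[X in _ * X]lnK ?posrE// -expRD -[leRHS]expR0 ler_expR.
have /le_ln1Dx : -1 < x / u - 1 by rewrite ltrBrDr addNr divr_gt0.
by rewrite addrC subrK ln_div ?posrE//; lra.
Qed.

Lemma expRXn (n : nat) x : (n = 0%N \/ 0 < x) -> expR (n%:R * ln x) = x ^+ n.
Proof.
by move=> [->|x0]; rewrite ?mul0r ?expR0 ?expr0// expRM_natl lnK// posrE.
Qed.

Lemma kl_affine_lin p u v x : kl_affine p u v x =
  kl_affine p u v 0 + (kl_affine p u v 1 - kl_affine p u v 0) * x.
Proof. by rewrite /kl_affine; ring. Qed.
End affine_minorant.

(** * The exponential of the divergence as an inverse beta weight *)

Section inverse_beta_weight.
Context (R : realType) (j e : nat) (p : R).
Let c : R := p ^+ j * (1 - p) ^+ e.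

(* [exp ((j + e) * kl p x)] when [p = j / (j + e)]; the absolute value matters only
   outside of [0, 1], where it keeps the function nonnegative. *)
Definition kl_exp (x : \bar R) : \bar R :=
  let w := `|fine x ^+ j * (1 - fine x) ^+ e| in
  if w == 0 then +oo%E else (c / w)%:E.

Hypothesis je : (0 < j + e)%N.

Hypothesis j_p : (j + e)%:R * p = j%:R.

Let e_p : (j + e)%:R * (1 - p) = e%:R.
Proof. by rewrite mulrBr j_p mulr1 natrD addrAC subrr add0r. Qed.

Lemma kl_mode01 : 0 <= p <= 1.
Proof.
have m0 : 0 < (j + e)%:R :> R by rewrite ltr0n.
apply/andP; split; first by rewrite -(pmulr_rge0 _ m0) j_p.
by rewrite -(ler_pM2l m0) j_p mulr1 ler_nat leq_addr.
Qed.

(** If [p] is [0] or [1], the corresponding exponent [j] or [e] is zero, so the factor is [1] on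
    both sides. *)
Let cE : expR ((j + e)%:R * (p * ln p + (1 - p) * ln (1 - p))) = c.
Proof.
rewrite mulrDr !mulrA j_p e_p expRD.
have m0 : 0 < (j + e)%:R :> R by rewrite ltr0n.
rewrite !expRXn//.
  have [->|e0] := eqVneq e 0%N; [by left|right].
  by rewrite -(pmulr_rgt0 _ m0) e_p ltr0n lt0n.
have [->|j0] := eqVneq j 0%N; [by left|right].
by rewrite -(pmulr_rgt0 _ m0) j_p ltr0n lt0n.
Qed.

Lemma beta_weight_mode_gt0 : 0 < p ^+ j * (1 - p) ^+ e.
Proof. by rewrite -[X in 0 < X]/c -cE expR_gt0. Qed.

Lemma kl_exp_ge0 x : (0 <= kl_exp x)%E.
Proof.
rewrite /kl_exp; case: ifP => // _; rewrite lee_fin divr_ge0//.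
by rewrite -cE expR_ge0.
Qed.

Lemma measurable_kl_exp : measurable_fun [set: \bar R] kl_exp.
Proof.
pose w (x : \bar R) := `|fine x ^+ j * (1 - fine x) ^+ e|.
have mw : measurable_fun [set: \bar R] w.
  apply: measurableT_comp => //; apply: measurable_funM;
    apply: measurable_funX => //.
  exact: measurable_funB.
apply: measurable_fun_ifT => //; first exact: measurable_fun_eqr.
apply/measurable_EFinP; apply: measurable_funM => //.
rewrite (_ : (fun x => _) = fun x => w x `^ (- 1)).
  by apply: (measurableT_comp (measurable_powR (-1))).
by apply/funext => x; rewrite powR_inv1 ?normr_ge0.
Qed.

(** An equality unless the weight vanishes; there the product of [+oo] and [0] is [0]. This is the
    hypothesis on [phi] in [integral_quantile_tail]. *)
Lemma kl_exp_weight x : 0 <= x <= 1 ->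
  (kl_exp x%:E * (x ^+ j * (1 - x) ^+ e)%:E <= c%:E)%E.
Proof.
move=> /andP[x0 x1]; rewrite /kl_exp /=.
have w0 : 0 <= x ^+ j * (1 - x) ^+ e by rewrite mulr_ge0// exprn_ge0// subr_ge0.
rewrite ger0_norm//; case: eqVneq => [->|w]; last by rewrite -EFinM divfK.
by rewrite mule0 lee_fin -cE expR_ge0.
Qed.

(** The left side factors as [c * a ^+ j * a' ^+ e], with [a] and [a'] the exponentials of the two
    tangent terms. After multiplication by the weight, the factors [a * x] and [a' * (1 - x)] are at
    most [1]. *)
Lemma expR_kl_affine_le u v x : 0 < u -> 0 < v -> 0 <= x <= 1 ->
  ((expR ((j + e)%:R * kl_affine p u v x))%:E <= kl_exp x%:E)%E.
Proof.
move=> u0 v0 /andP[x0 x1]; rewrite /kl_exp /=.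
have y0 : 0 <= 1 - x by rewrite subr_ge0.
have w0 : 0 <= x ^+ j * (1 - x) ^+ e by rewrite mulr_ge0// exprn_ge0.
rewrite ger0_norm//; case: eqVneq => [_|w]; first by rewrite leey.
rewrite lee_fin ler_pdivlMr ?lt_def ?w//.
have -> : (j + e)%:R * kl_affine p u v x =
    (j + e)%:R * (p * ln p + (1 - p) * ln (1 - p))
    + j%:R * (1 - ln u - x / u) + e%:R * (1 - ln v - (1 - x) / v).
  rewrite -[in RHS]j_p -e_p /kl_affine; set A := 1 - ln u - _;
    set B := 1 - ln v - _.
  by rewrite -[_ * p * A]mulrA -[_ * _ * B]mulrA -!mulrDr.
rewrite !expRD cE !expRM_natl.
have : 0 <= c by rewrite -cE expR_ge0.
move: (c) => c' c'0.
set a := expR _; set a' := expR _.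
rewrite (_ : _ * (x ^+ j * _) = c' * ((a * x) ^+ j * (a' * (1 - x)) ^+ e));
  last first.
  by rewrite !exprMn -!mulrA; congr (_ * _); congr (_ * _); rewrite mulrCA.
rewrite ler_piMr//.
by rewrite mulr_ile1 ?exprn_ile1 ?exprn_ge0 ?mulr_ge0 ?expR_ge0 ?expR_tangent_le1.
Qed.
End inverse_beta_weight.

(** * Stirling-type bounds *)

Section log_bounds.
Context (R : realType).
Implicit Types x t : R.

Lemma ge0_of_derive_ge0 (f df : R -> R) :
  (forall x, is_derive x 1 f (df x)) -> (forall x, 0 <= x -> 0 <= df x) ->
  f 0 = 0 -> forall x, 0 <= x -> 0 <= f x.
Proof.
move=> fdf df0 f0 x x0.
have [|y] := @MVT_segment _ f df 0 x x0 (fun y _ => fdf y).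
  by apply: derivable_within_continuous => z _; have [] := fdf z.
rewrite in_itv/= f0 !subr0 => /andP[y0 _] ->.
by rewrite mulr_ge0// df0.
Qed.

(* At [t = ln (n.+1 / n)] this says that the trapezoidal rule overestimates the
   integral of [1 / x] over [[n, n.+1]]. *)
Lemma expR_trapezoid t : 0 <= t -> 2 * t <= expR t - expR (- t).
Proof.
move=> t0; rewrite -subr_ge0.
pose f : R -> R := fun t => expR t - expR (- t) - 2 * t.
apply: (@ge0_of_derive_ge0 f (fun t => expR t + expR (- t) - 2)) => //.
- move=> x; rewrite /f.
  have ? : is_derive x 1 (fun t : R => expR (- t)) (- expR (- x)).
    have := @is_derive1_comp _ expR -%R x _ _ (is_derive_expR _)
      (is_deriveNid _ _).
    by move/is_derive_eq; apply; rewrite ?mulrN1 ?mulN1r.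
  apply: is_derive_eq.
  by rewrite opprK /GRing.scale /= mulr1.
- move=> x x0; have ab : expR x * expR (- x) = 1.
    by rewrite expRN divff// gt_eqF ?expR_gt0.
  (* The derivative is a square times an exponential. *)
  rewrite (_ : _ - _ = expR (- x) * (expR x - 1) ^+ 2).
    by rewrite mulr_ge0 ?expR_ge0 ?sqr_ge0.
  move: ab; set a := expR x; set b := expR (- x) => ab.
  by transitivity (a * (a * b) - 2 * (a * b) + b); [rewrite ab|]; ring.
- by rewrite /f oppr0 mulr0 !subrr.
Qed.

(* At the same [t], the midpoint rule underestimates that integral. *)
Lemma expR_midpoint t : 0 <= t -> 2 * (expR t - 1) <= t * (expR t + 1).
Proof.
move=> t0; rewrite -subr_ge0.
pose f : R -> R := fun t => t * (expR t + 1) - 2 * (expR t - 1).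
apply: (@ge0_of_derive_ge0 f (fun t => 1 + (t - 1) * expR t)) => //.
- move=> x; rewrite /f; apply: is_derive_eq.
  rewrite /GRing.scale /=; lra.
- move=> x x0; have := expR_ge1Dx (- x).
  rewrite -(ler_pM2r (expR_gt0 x)) -expRD addNr expR0; lra.
- by rewrite /f expR0 mul0r subrr mulr0 subrr.
Qed.

(** Midpoint and trapezoidal bounds at [t = ln (n.+1 / n)]. The excess over [2] on the right
    telescopes in [n]. *)
Lemma ln_succ_bounds (n : nat) : (0 < n)%N ->
  2 <= (2 * n%:R + 1) * ln (n.+1%:R / n%:R : R) <= 2 + (n%:R^-1 - n.+1%:R^-1) / 2.
Proof.
move=> n0; set x : R := n%:R; have x0 : 0 < x by rewrite ltr0n.
have nE : n.+1%:R = x + 1 :> R by rewrite -natr1.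
rewrite nE; set t := ln _.
have eE : expR t = (x + 1) / x by rewrite lnK// posrE divr_gt0// addr_gt0.
have t0 : 0 <= t.
  by rewrite ln_ge0// ler_pdivlMr// mul1r lerDl.
apply/andP; split.
  have := expR_midpoint t0; rewrite eE.
  rewrite -(ler_pM2l x0) (_ : x * (2 * _) = 2); last by field; rewrite gt_eqF.
  rewrite (_ : x * (t * _) = (2 * x + 1) * t)//; by field; rewrite gt_eqF.
have := expR_trapezoid t0; rewrite expRN eE.
have c0 : 0 < (2 * x + 1) / 2 by rewrite divr_gt0// addr_gt0// mulr_gt0.
rewrite -(ler_pM2l c0) (_ : _ * (2 * t) = (2 * x + 1) * t); last by field.
rewrite (_ : _ * (_ - _) = 2 + (x^-1 - (x + 1)^-1) / 2)//.
by field; rewrite !gt_eqF// addr_gt0.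
Qed.
End log_bounds.

Section central_binomial.
Context (R : realType).

(* Converges to [2 * pi] by Stirling's formula. *)
Definition stirling_ratio (n : nat) : R :=
  (n`!%:R * expR n%:R / n%:R ^+ n) ^+ 2 / n%:R.

Lemma stirling_ratioS n : (0 < n)%N -> stirling_ratio n.+1 =
  stirling_ratio n * expR (2 - (2 * n%:R + 1) * ln (n.+1%:R / n%:R)).
Proof.
move=> n0; set x : R := n%:R; set z : R := n.+1%:R.
have x0 : x != 0 by rewrite pnatr_eq0 -lt0n.
have z0 : z != 0 by rewrite pnatr_eq0.
have y0 : 0 < z / x by rewrite divr_gt0 ?ltr0n.
have xn0 : x ^+ n != 0 by rewrite expf_neq0.
have zn0 : z ^+ n != 0 by rewrite expf_neq0.
rewrite expRB (_ : (2 * x + 1) * _ = (2 * n).+1%:R * ln (z / x)); last first.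
  by rewrite -[(2 * n).+1%:R]natr1 natrM.
rewrite expRM_natl lnK// exprS mulnC exprM !expr_div_n.
have -> : expR 2 = expR 1 ^+ 2 :> R by rewrite -expRM_natl mulr1.
rewrite /stirling_ratio -/x -/z factS natrM -/z [z ^+ n.+1]exprS
  (_ : z = x + 1) ?expRD; last first.
  by rewrite /z -natr1.
rewrite -(_ : z = x + 1); last by rewrite /z -natr1.
move: (z ^+ n) (x ^+ n) zn0 xn0 => zn xn zn0 xn0.
by field; rewrite xn0 zn0 x0 nat1r z0.
Qed.

(** All three members equal [expR 2] at [n = 1]. By [ln_succ_bounds] the ratio does not increase,
    while its product with [expR (- n^-1 / 2)] does not decrease. *)
Lemma stirling_ratio_bounds n : (0 < n)%N ->
  expR (3 / 2 + n%:R^-1 / 2) <= stirling_ratio n <= expR 2.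
Proof.
elim: n => // -[_ _|n IH _].
  rewrite /stirling_ratio (_ : 1`! = 1%N)// !expr1 !divr1 mul1r -expRM_natl mulr1.
  by rewrite !ler_expR; apply/andP; split; lra.
rewrite stirling_ratioS//; have /andP[lo hi] := IH isT.
have /andP[h1 h2] := @ln_succ_bounds R n.+1 isT.
move: (_ * ln _) h1 h2 => t h1 h2; move: (n.+1%:R^-1)
  (n.+2%:R^-1) lo h2 => a b lo h2; apply/andP; split.
  apply: le_trans (ler_pM _ _ lo (lexx _)); rewrite ?expR_ge0//.
  by rewrite -expRD ler_expR; lra.
rewrite -[leRHS]mulr1 ler_pM ?expR_ge0//.
  by apply: le_trans lo; exact: expR_ge0.
by rewrite -[leRHS]expR0 ler_expR; lra.
Qed.

(** For positive [j + e], the probability that a binomial variable with [j + e] trials and mean [j]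
    equals its mean. *)
Definition binomial_mode (j e : nat) : R :=
  'C(j + e, j)%:R * (j%:R / (j + e)%:R) ^+ j * (e%:R / (j + e)%:R) ^+ e.

(** In terms of Stirling ratios the exponentials cancel, and the claim becomes that the ratio at
    [j + e] is at most the product of those at [j] and [e]: the former is at most [expR 2], the
    latter at least [expR 3]. *)
Lemma binomial_mode_sqr (j e : nat) : (0 < j)%N -> (0 < e)%N ->
  binomial_mode j e ^+ 2 * (j%:R * e%:R) <= (j + e)%:R.
Proof.
move=> j0 e0.
have jN0 : j%:R != 0 :> R by rewrite pnatr_eq0 -lt0n.
have eN0 : e%:R != 0 :> R by rewrite pnatr_eq0 -lt0n.
have m0 : (0 < j + e)%N by rewrite addn_gt0 j0.
have mN0 : (j + e)%:R != 0 :> R by rewrite pnatr_eq0 -lt0n.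
have H : binomial_mode j e ^+ 2 * (j%:R * e%:R) *
  (stirling_ratio j * stirling_ratio e) =
    (j + e)%:R * stirling_ratio (j + e).
  have bE := bin_fact (leq_addr e j); rewrite addKn in bE.
  rewrite /binomial_mode /stirling_ratio -bE !natrM.
  rewrite (natrD _ j e) expRD -(natrD _ j e) !expr_div_n !exprD.
  have f0 k : k`!%:R != 0 :> R by rewrite pnatr_eq0 -lt0n fact_gt0.
  have := f0 j; have := f0 e.
  have : j%:R ^+ j != 0 :> R by exact: expf_neq0.
  have : e%:R ^+ e != 0 :> R by exact: expf_neq0.
  have : (j + e)%:R ^+ j != 0 :> R by exact: expf_neq0.
  have : (j + e)%:R ^+ e != 0 :> R by exact: expf_neq0.
  move: (j%:R ^+ j) (e%:R ^+ e) ((j + e)%:R ^+ j) ((j + e)%:R ^+ e).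
  move: (j%:R) (e%:R) ((j + e)%:R) (j`!%:R) (e`!%:R) ('C(_, _)%:R) (expR _)
    (expR _) jN0 eN0 mN0.
  move=> J E M fj fe C xj xe J0 E0 M0 jj ee mj me me0 mj0 ee0 jj0 fe0 fj0.
  by field; rewrite M0 me0 mj0 E0 ee0 J0 jj0.
have /andP[lj _] := stirling_ratio_bounds j0.
have /andP[le _] := stirling_ratio_bounds e0.
have /andP[_ hm] := stirling_ratio_bounds m0.
have pos : 0 < stirling_ratio j * stirling_ratio e.
  by rewrite mulr_gt0// ?(lt_le_trans (expR_gt0 _) lj) ?(lt_le_trans
    (expR_gt0 _) le).
rewrite -(ler_pM2r pos) H ler_pM2l ?ltr0n//; apply: (le_trans hm).
apply: (@le_trans _ _ (expR (3 / 2) * expR (3 / 2))).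
  by rewrite -expRD ler_expR; lra.
rewrite ler_pM ?expR_ge0//.
  by apply: le_trans lj; rewrite ler_expR lerDl divr_ge0 ?invr_ge0.
by apply: le_trans le; rewrite ler_expR lerDl divr_ge0 ?invr_ge0.
Qed.
End central_binomial.

(** * The constant B(N) and its growth *)

Section Bconst.
Context (R : realType).

(** The shifts by [2] and [1] admit [j = 0] or [e = 0], where the mode probability is [1], and match
    the bounds on [a] and [1 - a] in [Bconst_le]. For positive [j] and [e] they cost a factor of at
    most [3 * 2]. *)
Lemma binomial_mode_le (j e : nat) : (0 < j + e)%N ->
  binomial_mode R j e ^+ 2 * (j.+2%:R * e.+1%:R) <= 6 * (j + e).+1%:R.
Proof.
case: (posnP j) => [->|j0]; case: (posnP e) => [->|e0] // _.
- rewrite /binomial_mode bin0 expr0 add0n divff ?pnatr_eq0 -?lt0n// expr1n !mulr1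
  expr1n mul1r.
  by rewrite -natrM -natrM ler_nat leq_mul2r orbT.
- rewrite /binomial_mode addn0 binn expr0 divff ?pnatr_eq0 -?lt0n// expr1n !mulr1
  expr1n mul1r.
  by rewrite -natrM ler_nat; lia.
have h := @binomial_mode_sqr R j e j0 e0.
apply: (@le_trans _ _ (binomial_mode R j e ^+ 2 * (6 * (j%:R * e%:R)))).
  rewrite ler_wpM2l ?sqr_ge0// -!natrM ler_nat.
  by nia.
rewrite mulrCA ler_pM2l//; apply: (le_trans h).
by rewrite ler_nat.
Qed.

(** The condition on [n] says that [n.+1 * a > 1], so the floor is at least [1]; [a < 1] keeps it
    below [n.+1]. *)
Lemma kfloor_bounds (a : R) (n : nat) : 0 < a < 1 -> a^-1 - 1 < n%:R ->
  [/\ (0 < kfloor a n <= n)%N, (kfloor a n)%:R <= n.+1%:R * a &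
      n.+1%:R * a < (kfloor a n).+1%:R].
Proof.
move=> /andP[a0 a1] an.
have x1 : 1 < n.+1%:R * a.
  by rewrite -natr1 mulrC -ltr_pdivrMl// mulr1 -ltrBlDr.
have x0 : 0 <= n.+1%:R * a by apply: ltW; apply: lt_trans x1.
have /andP[h1 h2] := truncn_itv x0; rewrite -/(kfloor a n) in h1 h2.
split => //; apply/andP; split.
  by rewrite -ltnS -(ltr_nat R); apply: lt_trans h2.
rewrite -ltnS -(ltr_nat R); apply: le_lt_trans h1 _.
by rewrite -[ltRHS]mulr1 ltr_pM2l// ltr0n.
Qed.

(** The ceiling of [m - x] is [m] minus the floor of [x]. The right side is written to show that
    [k - 1] scores lie above the threshold. *)
Lemma kfloor_ceil (a : R) (n : nat) : 0 < a < 1 -> a^-1 - 1 < n%:R ->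
  Num.ceil (n.+1%:R * (1 - a)) = (n - (kfloor a n).-1)%:Z.
Proof.
move=> a01 an; have [/andP[k0 kn] h1 h2] := kfloor_bounds a01 an.
apply: ceil_def; rewrite -subzn; last by rewrite (leq_trans (leq_pred _)).
rewrite !intrB /= -[(Posz n)%:~R]/(n%:R) -[(Posz _.-1)%:~R]/(_.-1%:R) -[1%:~R]/(1
  : R).
have kE : (kfloor a n)%:R = (kfloor a n).-1%:R + 1 :> R by rewrite natr1 prednK.
move: h1 h2; rewrite -[(kfloor a n).+1%:R]natr1 -[n.+1%:R]natr1 kE => h1 h2.
by apply/andP; split; lra.
Qed.

Lemma kfloor_mode (a : R) (n : nat) (j := (kfloor a n).-1) (e :=
  (n - kfloor a n)%N) :
  (1 < n)%N -> 0 < a < 1 -> a^-1 - 1 < n%:R ->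
  [/\ (j + e).+1 = n, (0 < j + e)%N &
      ((kfloor a n)%:R - 1) / (n%:R - 1) = j%:R / (j + e)%:R :> R].
Proof.
move=> n1 a01 an; have [/andP[k0 kn] h1 h2] := kfloor_bounds a01 an.
have jeE : (j + e).+1 = n by rewrite /j /e; lia.
split => //; first by lia.
rewrite -[in (n%:R - 1)]jeE -natr1 addrK; congr (_ / _).
by rewrite -[in LHS](prednK k0) -natr1 addrK.
Qed.

(** The beta normalization [n! / ((k-1)! (n-k)!)] counts the pairs of a pivot and a set of [k - 1]
    other points. *)
Lemma BconstE (a : R) (n : nat) (j := (kfloor a n).-1) (e := (n - kfloor a n)%N)
    (p := ((kfloor a n)%:R - 1) / (n%:R - 1)) :
  (1 < n)%N -> 0 < a < 1 -> a^-1 - 1 < n%:R ->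
  Bconst a n = (n * 'C(n.-1, j))%:R * (p ^+ j * (1 - p) ^+ e).
Proof.
move=> n1 a01 an; have [k0n h1 h2] := kfloor_bounds a01 an.
have [jeE je0 pE] := kfloor_mode n1 a01 an.
rewrite /Bconst -/p beta_pdf_factE//; last first.
  rewrite /p pE -/j -/e divr_ge0//= ler_pdivrMr ?ltr0n// mul1r ler_nat; lia.
rewrite -/j -/e -[LHS]mulrA; congr (_ * _).
apply: (@mulIf _ (j`!%:R * e`!%:R)); first by rewrite mulf_neq0 ?pnatr_eq0 -?lt0n
  ?fact_gt0.
rewrite divfK ?mulf_neq0 ?pnatr_eq0 -?lt0n ?fact_gt0//.
rewrite -jeE factS /= -(bin_fact (leq_addr e j)) addKn !natrM.
by rewrite !mulrA.
Qed.

(** [Bconst] is [n] times a binomial mode probability. Since [a] is at most [j.+2 / n.+1] and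
    [1 - a] at most [e.+1 / n.+1], [binomial_mode_le] bounds its square times [a * (1 - a)] by
    [6 * n], and [6 <= 3 ^+ 2]. *)
Lemma Bconst_le (a : R) (n : nat) : (1 < n)%N -> 0 < a < 1 -> a^-1 - 1 < n%:R ->
  `|Bconst a n| <= 3 * Num.sqrt (n%:R / (a * (1 - a))).
Proof.
move=> n1 a01 an; have [/andP[k0 kn] h1 h2] := kfloor_bounds a01 an.
have [jeE je0 pE] := kfloor_mode n1 a01 an.
rewrite BconstE// pE; set j := _.-1 in jeE je0 pE *;
  set e := (_ - _)%N in jeE je0 pE *.
have m0 : (j + e)%:R != 0 :> R by rewrite pnatr_eq0 -lt0n.
have qE : 1 - j%:R / (j + e)%:R = e%:R / (j + e)%:R :> R.
  by rewrite -[X in X - _](divff m0) -mulrBl natrD addrAC subrr add0r.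
have -> : (n * 'C(n.-1, j))%:R * ((j%:R / (j + e)%:R) ^+ j * (1 - j%:R /
  (j + e)%:R) ^+ e)
   = n%:R * binomial_mode R j e.
  by rewrite qE /binomial_mode natrM -jeE /= !mulrA.
have [a0 a1] := andP a01.
have a1' : 0 < a * (1 - a) by rewrite mulr_gt0 ?subr_gt0.
have b0 : 0 <= binomial_mode R j e by rewrite !mulr_ge0 ?exprn_ge0 ?divr_ge0.
rewrite ger0_norm ?mulr_ge0//.
rewrite -(@ler_pXn2r _ 2)// ?nnegrE ?mulr_ge0 ?sqrtr_ge0//.
rewrite [leRHS]exprMn sqr_sqrtr ?divr_ge0 ?(ltW a1')//.
rewrite [leRHS]mulrA ler_pdivlMr// exprMn.
have hb := binomial_mode_le je0; rewrite jeE in hb.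
have n20 : 0 < n.+1%:R :> R by rewrite ltr0n.
have ha : a <= j.+2%:R / n.+1%:R.
  by rewrite ler_pdivlMr// mulrC; apply: ltW; rewrite /j prednK.
have ha' : 1 - a <= e.+1%:R / n.+1%:R.
  rewrite ler_pdivlMr// mulrBl mul1r mulrC.
  apply: (@le_trans _ _ (n.+1%:R - (kfloor a n)%:R));
    first by rewrite lerD2l lerN2.
  by rewrite -natrB ?ler_nat /e; lia.
have haa : a * (1 - a) <= (j.+2%:R * e.+1%:R) / n.+1%:R ^+ 2.
  rewrite expr2 invfM mulrACA.
  by rewrite ler_pM// ?ltW ?subr_gt0.
apply: (@le_trans _ _ (n%:R ^+ 2 * binomial_mode R j e ^+ 2 *
  (j.+2%:R * e.+1%:R / n.+1%:R ^+ 2))).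
  by rewrite ler_wpM2l// mulr_ge0 ?sqr_ge0.
set K := _ * e.+1%:R in hb *.
rewrite (_ : _ * (K / _) = (binomial_mode R j e ^+ 2 * K) *
  (n%:R / n.+1%:R) ^+ 2); last first.
  by move: n.+1%:R n20 => M M0; field; rewrite gt_eqF.
apply: (@le_trans _ _ (binomial_mode R j e ^+ 2 * K)).
  rewrite ler_piMr ?mulr_ge0 ?sqr_ge0// exprn_ile1 ?divr_ge0//.
  by rewrite ler_pdivrMr// mul1r ler_nat.
by apply: (le_trans hb); rewrite ler_wpM2r//; lra.
Qed.
End Bconst.

(** * The PAC-Bayes argument for the miscoverage rate *)

Section pac_bayes.
Context (R : realType) (dX dY dT dO : measure_display)
  (X : measurableType dX) (Y : measurableType dY) (Theta : measurableType dT)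
  (Omega : measurableType dO).
Variables (D : probability (X * Y)%type R) (s : X -> Y -> Theta -> R)
  (P : probability Theta R) (Pr : probability Omega R) (N : nat)
  (Z : 'I_N -> {RV Pr >-> (X * Y)%type}) (alpha : R).
Hypothesis ms : measurable_fun [set: (X * Y) * Theta]
  (fun w => s w.1.1 w.1.2 w.2).
Hypothesis no_ties : {ae P, forall theta, forall t : R,
  D [set z | s z.1 z.2 theta = t] = 0%E}.
Hypothesis Z_iid : iid D Z.
Hypothesis alpha01 : 0 < alpha < 1.
Hypothesis N_gt1 : (1 < N)%N.
Hypothesis N_alpha : alpha^-1 - 1 < N%:R.

Let k := kfloor alpha N.
Let j := k.-1.
Let e := (N - k)%N.
Let p : R := (k%:R - 1) / (N%:R - 1).
Let tau (x : Omega * Theta) : R :=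
  calibrated_threshold s (fun i => Z i x.1) alpha x.2.
Let L (x : Omega * Theta) : \bar R := D [set z | tau x < s z.1 z.2 x.2].

Let k_bounds : (0 < k <= N)%N.
Proof. by have [] := kfloor_bounds alpha01 N_alpha. Qed.

Let j_ltN : (j < N)%N.
Proof. by rewrite /j; have := k_bounds; lia. Qed.

Let jeE : (j + e).+1 = N.
Proof. by have [] := kfloor_mode N_gt1 alpha01 N_alpha. Qed.

Let j_p : (j + e)%:R * p = j%:R.
Proof.
have [_ je0 pE] := kfloor_mode N_gt1 alpha01 N_alpha.
by rewrite /p pE mulrC divfK// pnatr_eq0 -lt0n.
Qed.

Let je_gt0 : (0 < j + e)%N.
Proof. by have [] := kfloor_mode N_gt1 alpha01 N_alpha. Qed.

Lemma Bconst_gt0 : 0 < Bconst alpha N.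
Proof.
rewrite BconstE// mulr_gt0// ?(beta_weight_mode_gt0 je_gt0 j_p)// ltr0n muln_gt0.
by rewrite bin_gt0; have := j_ltN; lia.
Qed.

Let tauE x : tau x =
  emp_quantile (fun i => s (Z i x.1).1 (Z i x.1).2 x.2) ((N - j)%:R / N%:R).
Proof. by rewrite /tau /calibrated_threshold kfloor_ceil. Qed.

Let measurable_L : measurable_fun [set: Omega * Theta] L.
Proof.
have mtau : measurable_fun [set: Omega * Theta] tau.
  rewrite (_ : tau = fun x => emp_quantile
    (fun i => s (Z i x.1).1 (Z i x.1).2 x.2) ((N - j)%:R / N%:R));
      last exact/funext/tauE.
  apply: (@measurable_emp_quantile _ _ _ _ _
    (fun i x => s (Z i x.1).1 (Z i x.1).2 x.2)).
    by rewrite subn_gt0 j_ltN leq_subr.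
  move=> i; apply: (measurableT_comp ms (g := fun x => (Z i x.1, x.2))).
  by apply: measurable_fun_pair => //; exact: measurableT_comp.
apply: (@measurable_prob_gt _ _ _ _ _ D tau (fun y => s y.2.1 y.2.2 y.1.2)) => //.
apply: (measurableT_comp ms (g := fun y : Omega * Theta * (X * Y) =>
  (y.2, y.1.2))).
by apply: measurable_fun_pair => //; exact: measurableT_comp.
Qed.

Let phi := kl_exp j e p.

Let measurable_phiL : measurable_fun [set: Omega * Theta] (phi \o L).
Proof. by apply: measurableT_comp => //; exact: measurable_kl_exp. Qed.

Let phiL_ge0 x : (0 <= (phi \o L) x)%E.
Proof. exact: kl_exp_ge0. Qed.

(** The prior does not depend on the sample, so Tonelli exchanges the integrals; then
    [integral_quantile_tail] applies for almost every fixed [theta]. *)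
Let integral_phiL : (\int[Pr]_w \int[P]_theta phi (L (w, theta)) <=
  (Bconst alpha N)%:E)%E.
Proof.
have := @fubini_tonelli _ _ _ _ _ Pr P (phi \o L) measurable_phiL phiL_ge0.
rewrite /fubini_F /fubini_G /= => ->.
have <- : (\int[P]_x (cst (Bconst alpha N)%:E) x = (Bconst alpha N)%:E)%E.
  transitivity ((Bconst alpha N)%:E * P setT)%E; first exact: integral_cst.
  by rewrite probability_setT mule1.
apply: ae_ge0_le_integral => //.
- by move=> t _; apply: integral_ge0 => w _; exact: phiL_ge0.
- exact: (@measurable_fun_fubini_tonelli_G _ _ _ _ _ Pr (phi \o L)).
- by move=> t _ /=; rewrite lee_fin ltW// Bconst_gt0.
apply: filterS no_ties => theta theta_ties _ /=.
rewrite BconstE//.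
have mS : measurable_fun [set: X * Y] (fun z => s z.1 z.2 theta).
  by apply: (measurableT_comp ms (g := fun z => (z, theta)));
    exact: measurable_fun_pair.
rewrite (_ : (fun w => _) = fun w => phi (D [set z | emp_quantile
  (fun i => s (Z i w).1 (Z i w).2 theta) ((N - j)%:R / N%:R) < s z.1 z.2 theta]));
  last by apply/funext => w; rewrite /L tauE.
apply: (integral_quantile_tail Z_iid mS theta_ties) => //.
- exact: measurable_kl_exp.
- exact: kl_exp_ge0.
move=> x x01; have -> : (N - j.+1 = e)%N by rewrite /e /j; have := k_bounds; lia.
exact: kl_exp_weight.
Qed.

(** The event involves only the prior, so a single event serves every [Q]. *)
Lemma pac_bayes_event (delta : R) : 0 < delta ->
  exists E : set Omega, [/\ measurable E, ((1 - delta)%:E < Pr E)%E &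
    forall w, E w ->
      (\int[P]_theta phi (L (w, theta)) <= (Bconst alpha N / delta)%:E)%E].
Proof.
move=> delta0.
pose V w := (\int[P]_theta phi (L (w, theta)))%E.
have mV : measurable_fun [set: Omega] V.
  exact: (@measurable_fun_fubini_tonelli_F _ _ _ _ _ P (phi \o L)).
exists [set w | (V w <= (Bconst alpha N / delta)%:E)%E]; split => //.
  by rewrite -[X in measurable X]setTI; exact: emeasurable_fun_infty_c.
apply: strict_markov => //.
  by move=> w; apply: integral_ge0 => t _; exact: phiL_ge0.
exact: Bconst_gt0.
Qed.

Lemma kl_Lcov_le (w : Omega) (Q : probability Theta R) (M : R) : 0 < M ->
  (\int[P]_theta phi (L (w, theta)) <= M%:E)%E ->
  (kl p%:E (Lcov D s (fun i => Z i w) alpha Q)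
    <= (KL Q P + (ln M)%:E) / (N%:R - 1)%:E)%E.
Proof.
move=> M0 VM.
have mLw : measurable_fun [set: Theta] (fun t => L (w, t)).
  by apply: measurableT_comp => //; exact: measurable_fun_pair.
have mA t : measurable [set z | tau (w, t) < s z.1 z.2 t].
  apply: measurable_ltr_set => //.
  by apply: (measurableT_comp ms (g := fun z => (z, t)));
    exact: measurable_fun_pair.
have Lfin t : L (w, t) \is a fin_num by exact: fin_num_measure.
pose l t := fine (L (w, t)).
have lE t : L (w, t) = (l t)%:E by rewrite fineK.
have l01 t : 0 <= l t <= 1.
  by rewrite -!lee_fin -lE measure_ge0/= probability_le1.
have ml : measurable_fun [set: Theta] l by exact: measurableT_comp.
have LcovE : Lcov D s (fun i => Z i w) alpha Q = (\int[Q]_t (l t)%:E)%E.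
  apply: eq_integral => t _; rewrite -lE /L; congr (D _).
  by apply/seteqP; split => z /=; rewrite /prediction_set /= ltNge => /negP.
have il : Q.-integrable setT (EFin \o l).
  apply: measurable_bounded_integrable => //.
    by rewrite -ge0_fin_numE// fin_num_measure.
  exists 1; split; first exact: num_real.
  move=> c c1 t _ /=; have /andP[l0 l1] := l01 t.
  by rewrite ger0_norm// (le_trans l1)// ltW.
have q_fin := integrable_fin_num measurableT il.
pose q := fine (\int[Q]_t (EFin \o l) t).
have qE : (\int[Q]_t (l t)%:E = q%:E)%E by rewrite /q fineK.
have q01 : 0 <= q <= 1.
  rewrite -!lee_fin -qE; apply/andP; split.
    by apply: integral_ge0 => t _; rewrite lee_fin; case/andP: (l01 t).
  rewrite -[leRHS](probability_setT Q) -[leRHS]mul1e.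
  have <- := integral_cst Q measurableT 1%E.
  apply: ge0_le_integral => //.
  - by move=> t _; rewrite lee_fin; case/andP: (l01 t).
  - exact/measurable_EFinP.
  - by move=> t _; rewrite lee_fin; case/andP: (l01 t).
have mE : N%:R - 1 = (j + e)%:R :> R by rewrite -jeE -natr1 addrK.
have m0 : 0 < (j + e)%:R :> R by rewrite ltr0n.
rewrite LcovE qE mE inver gt_eqF//.
apply: kl_le_sup_affine => // [|u v u0 v0]; first exact: (kl_mode01 je_gt0 j_p).
rewrite lee_pdivlMr// -EFinM mulrC.
(* Intercept and slope of the minorant scaled by [N - 1]; as [L] lies in the unit interval,
   [|a0| + |a1|] bounds it. *)
set a0 := (j + e)%:R * kl_affine p u v 0.
set a1 := (j + e)%:R * (kl_affine p u v 1 - kl_affine p u v 0).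
have affE x : (j + e)%:R * kl_affine p u v x = a0 + a1 * x.
  by rewrite kl_affine_lin mulrDr mulrA.
have mAff : measurable_fun [set: Theta] (fun t => a0 + a1 * l t).
  by apply: measurable_funD => //; exact: measurable_funM.
have := @donsker_varadhan _ _ _ P Q (fun t => a0 + a1 * l t)
  (`|a0| + `|a1|) M mAff.
(* An affine function of the mean is the mean of the affine function, [Q] having total mass [1]. *)
rewrite affE; have -> : (a0 + a1 * q)%:E = (\int[Q]_t (a0 + a1 * l t)%:E)%E.
  rewrite (_ : (fun t => _) = (EFin \o cst a0) \+ (fun t => a1%:E *
    (EFin \o l) t))%E//.
  rewrite integralD//; [|exact: finite_measure_integrable_cst|exact:
    integrableZl].
  rewrite integralZl// qE EFinD EFinM; congr (_ + _)%E.
  transitivity (a0%:E * Q setT)%E; last by symmetry;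
    exact: (integral_cst Q measurableT a0%:E).
  by rewrite probability_setT mule1.
apply=> //.
  move=> t; apply: (le_trans (ler_normD _ _)); rewrite lerD2l normrM ler_piMr//.
  by have /andP[l0 l1] := l01 t; rewrite ger0_norm.
apply: le_trans VM; apply: ge0_le_integral => //.
- by apply/measurable_EFinP; exact: measurableT_comp.
- by apply: measurableT_comp => //; exact: measurable_kl_exp.
by move=> t _; rewrite -affE lE; exact: expR_kl_affine_le.
Qed.

End pac_bayes.
Theorem theorem1 (R : realType) (dX dY dO : measure_display)
    (X : measurableType dX) (Y : measurableType dY) (Omega : measurableType dO)
    (d : nat)
    (D : probability (X * Y)%type R)
    (s : X -> Y -> d.-tuple (measurableTypeR R) -> R)
    (P : probability (d.-tuple (measurableTypeR R)) R)
    (Pr : probability Omega R) (N : nat)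
    (Z : 'I_N -> {RV Pr >-> (X * Y)%type})
    (delta alpha : R)
    (s_measurable : measurable_fun
       [set: (X * Y) * d.-tuple (measurableTypeR R)]
       (fun w => s w.1.1 w.1.2 w.2))
    (s_no_ties : {ae P, forall theta, forall t : R,
       D [set z | s z.1 z.2 theta = t] = 0%E})
    (Z_iid : iid D Z)
    (delta01 : 0 < delta < 1)
    (alpha01 : 0 < alpha < 1)
    (N_gt1 : (1 < N)%N)
    (N_alpha : alpha^-1 - 1 < N%:R) :
  (exists E : set Omega, [/\ measurable E, ((1 - delta)%:E < Pr E)%E &
     forall w, E w -> forall Q : probability (d.-tuple (measurableTypeR R)) R,
       (kl (((kfloor alpha N)%:R - 1) / (N%:R - 1))%:E
           (Lcov D s (fun i => Z i w) alpha Q)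
        <= (KL Q P + (ln (Bconst alpha N / delta))%:E) / (N%:R - 1)%:E)%E])
  /\
  (exists C : R, forall (n : nat) (a : R),
     (1 < n)%N -> 0 < a < 1 -> a^-1 - 1 < n%:R ->
     `|Bconst a n| <= C * Num.sqrt (n%:R / (a * (1 - a)))).
Proof.
split; last by exists 3 => n a n1 a01 an; exact: Bconst_le.
have [delta0 _] := andP delta01.
have [E [mE PrE hE]] := pac_bayes_event s_measurable s_no_ties Z_iid alpha01
  N_gt1 N_alpha delta0.
exists E; split => // w Ew Q.
apply: (kl_Lcov_le s_measurable alpha01 N_gt1 N_alpha) (hE w Ew).
by rewrite divr_gt0 ?Bconst_gt0.
Qed.
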